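(* Let $\mathcal{L}$ be a finite relational language and let $\mathcal{F}$ be a family of finite (canonical) $\mathcal{L}$-structures (up to isomorphism) containing at least one structure of size at least $2$. Then $\mathcal{F}$ is strongly persistent if and only if $\mathcal{F}$ is weakly closed under substitutions and closed under substructures. Furthermore, if all predicate symbols of $\mathcal{L}$ have arity at most $2$, these are also equivalent to $\mathcal{F}$ being persistent.
   Context: Each predicate $P\in\mathcal{L}$ has arity $k(P)\ge1$. An $\mathcal{L}$-structure $M$ is canonical if each $P^M$ consists only of injective $k(P)$-tuples of $V(M)$; all structures below are canonical and may be empty. An embedding of $M$ in $N$ is an injective map $V(M)\to V(N)$ preserving every relation and its negation; $M$ is a substructure of $N$ if it embeds in $N$. For finite $M,N$, $p(M,N)$ is the number of $U\subseteq V(N)$ with $N|_U\cong M$ divided by $\binom{|N|}{|M|}$ (and $0$ if $|M|>|N|$). A sequence $(N_n)$ of finite structures is convergent if $|N_n|$ is strictly increasing and $\lim_n p(M,N_n)$ exists for every finite $M$; its limit is the function $\phi(M)=\lim_n p(M,N_n)$. A limit $\psi$ is a sub-object of a limit $\phi$ if there are a sequence $(N_n)$ converging to $\phi$ and sets $A_n\subseteq V(N_n)$ with $|A_n|/|N_n|\to c>0$ and $(N_n|_{A_n})$ converging to $\psi$. Let $Q(\phi)=\{M:\phi(M)>0\}$ and $P(\phi)=\bigcap_\psi Q(\psi)$ over all sub-objects $\psi$ of $\phi$; $\phi$ is weakly random if $P(\phi)=Q(\phi)$. $\mathcal{F}$ is persistent if $\mathcal{F}=P(\phi)$ for some limit $\phi$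 of finite $\mathcal{L}$-structures, and strongly persistent if this holds for some weakly random $\phi$. Given finite $F_1,F_2$ and $v\in V(F_1)$, a substitution of $v$ in $F_1$ by $F_2$ is a structure $F$ with maps $f_1\colon V(F_1)\setminus\{v\}\to V(F)$, $f_2\colon V(F_2)\to V(F)$ such that $V(F)=\mathrm{im}(f_1)\cup\mathrm{im}(f_2)$, $f_2$ is an embedding of $F_2$ in $F$, and for every $u\in V(F_2)$ the extension of $f_1$ sending $v$ to $f_2(u)$ is an embedding of $F_1$ in $F$. $\mathcal{F}$ is weakly closed under substitutions if for all $F_1,F_2\in\mathcal{F}$ and $v\in V(F_1)$ some substitution of $v$ in $F_1$ by $F_2$ lies in $\mathcal{F}$. *)

(* Defs.v *)
(* MathComp / MathComp-Analysis *)
From HB Require Import structures.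
From mathcomp Require Import all_boot all_order all_algebra.
From mathcomp Require Import all_classical all_reals all_analysis.

Set Implicit Arguments.
Unset Strict Implicit.
Unset Printing Implicit Defensive.

Import Order.TTheory GRing.Theory Num.Theory.
Import numFieldNormedType.Exports.

Local Open Scope classical_set_scope.
Local Open Scope ring_scope.

Record language := Language {
  symbol :> finType;
  arity : symbol -> nat;
  arity_gt0 : forall P, (0 < arity P)%N }.

(* Every finite structure is isomorphic to one on an ordinal, so vertex sets
   are taken to be ordinals; this keeps [fstruct L] in a universe small enough
   for [set (fstruct L)].  Size 0 is allowed. *)
Record fstruct (L : language) := FStruct {
  nvertices : nat;
  holds : forall P : L, pred ((arity P).-tuple 'I_nvertices);
  holds_uniq : forall (P : L) (t : (arity P).-tuple 'I_nvertices),
    holds t -> uniq t }.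

Arguments holds {L} M P t : rename.

Definition vertex (L : language) (M : fstruct L) : finType := 'I_(nvertices M).
Coercion vertex : fstruct >-> finType.

Section Structures.
Variable L : language.
Implicit Types M N : fstruct L.

Definition embedding M N (f : M -> N) : Prop :=
  injective f /\
  forall (P : L) (t : (arity P).-tuple M),
    holds N P (map_tuple f t) = holds M P t.

Definition substructure M N : Prop := exists f : M -> N, embedding f.

Definition isomorphic M N : Prop :=
  exists f : M -> N, bijective f /\ embedding f.

(* N|_U, with the elements of U relabelled along [enum_val : 'I_#|U| -> N]. *)
Definition induced_holds N (U : {set N}) (P : L)
    (t : (arity P).-tuple 'I_#|U|) : bool :=
  holds N P (map_tuple (@enum_val N (mem U)) t).

Lemma induced_holds_uniq N (U : {set N}) (P : L)
    (t : (arity P).-tuple 'I_#|U|) : induced_holds t -> uniq t.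
Proof. by move=> /holds_uniq /map_uniq. Qed.

Definition induced_on N (U : {set N}) : fstruct L :=
  FStruct (@induced_holds_uniq N U).

(* Families of structures up to isomorphism are represented by sets of
   structures satisfying this predicate. *)
Definition iso_closed (F : set (fstruct L)) : Prop :=
  forall M N, isomorphic M N -> F M -> F N.

Definition closed_under_substructures (F : set (fstruct L)) : Prop :=
  forall M N, substructure M N -> F N -> F M.

Definition extend (F1 : fstruct L) (v : F1) (T : Type)
    (f1 : {x : F1 | x != v} -> T) (w : T) (x : F1) : T :=
  if insub x is Some y then f1 y else w.

Definition substitution (F1 : fstruct L) (v : F1) (F2 F : fstruct L) : Prop :=
  exists (f1 : {x : F1 | x != v} -> F) (f2 : F2 -> F),
    [/\ range f1 `|` range f2 = setT,
        embedding f2 &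
        forall u : F2, embedding (extend f1 (f2 u))].

Definition weakly_closed_under_substitutions (F : set (fstruct L)) : Prop :=
  forall F1 F2 : fstruct L, F F1 -> F F2 ->
  forall v : F1, exists2 F' : fstruct L, substitution v F2 F' & F F'.

Section Limits.
Variable R : realType.

(* If #|M| > #|N|, the binomial coefficient is 0 and hence so is the
   quotient. *)
Definition density M N : R :=
  #|[pred U : {set N} | `[< isomorphic (induced_on U) M >]]|%:R
    / 'C(#|N|, #|M|)%:R.

Definition converges_to (S : nat -> fstruct L) (phi : fstruct L -> R) : Prop :=
  {homo (fun n => #|S n|) : m n / (m < n)%N} /\
  forall M, density M (S n) @[n --> \oo] --> phi M.

Definition is_limit (phi : fstruct L -> R) : Prop :=
  exists S, converges_to S phi.

Definition sub_object (psi phi : fstruct L -> R) : Prop :=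
  exists (S : nat -> fstruct L) (A : forall n, {set S n}) (c : R),
    [/\ converges_to S phi,
        0 < c,
        (#|A n|%:R / #|S n|%:R : R) @[n --> \oo] --> c &
        converges_to (fun n => induced_on (A n)) psi].

Definition Qset (phi : fstruct L -> R) : set (fstruct L) :=
  [set M | 0 < phi M].

Definition Pset (phi : fstruct L -> R) : set (fstruct L) :=
  \bigcap_(psi in [set psi | sub_object psi phi]) Qset psi.

Definition weakly_random (phi : fstruct L -> R) : Prop := Pset phi = Qset phi.

Definition persistent (F : set (fstruct L)) : Prop :=
  exists2 phi, is_limit phi & F = Pset phi.

Definition strongly_persistent (F : set (fstruct L)) : Prop :=
  exists2 phi, is_limit phi & weakly_random phi /\ F = Pset phi.

End Limits.
End Structures.

Arguments persistent {L} R F.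
Arguments strongly_persistent {L} R F.

(* Main.v *)
(* Necessity.  If F1 has positive density in psi, a positive fraction of the copies
   of F1 - v extend to copies of F1 through a positive fraction A of all vertices.
   Every such A contains a positive fraction of copies of F2: otherwise such sets A
   would converge, along a subsequence, to a sub-object avoiding F2.  Hence
   substitutions of v in F1 by F2 have positive total density in psi.  In arity at
   most 2 the substitution does not depend on psi, because it is unique up to
   isomorphism.

   Sufficiency.  Blow up every vertex of a structure in the family by a copy of a
   member G, again and again, so that every nonempty G occurs infinitely often, and
   let phi be a limit of the resulting structures.  A blow-up by M multiplies the
   largest relative size of an M-free vertex set by at most 1 - 1/|M|, so these sizes
   tend to 0.  By a second moment estimate the same holds, on average, for the
   structure induced on a random sample of s vertices, and the average is determined
   by phi.  So if S_n converges to phi and A_n has positive density in S_n, then a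
   sample of S_n meets A_n in a set which is too large to be M-free. *)
Require Import Defs.
From HB Require Import structures.
From mathcomp Require Import all_boot all_order all_algebra.
From mathcomp Require Import all_classical all_reals all_analysis.
From mathcomp Require Import lra.

Set Implicit Arguments.
Unset Strict Implicit.
Unset Printing Implicit Defensive.

Import Order.TTheory GRing.Theory Num.Theory.
Import numFieldNormedType.Exports.

Local Open Scope ring_scope.

(** * Embeddings and codes of structures *)

Section Embeddings.
Variable L : language.
Implicit Types M N K : fstruct L.

Lemma embedding_id M : embedding (@id M).
Proof.
split=> // P t; congr (holds M P _).
by apply: val_inj; rewrite /= map_id.
Qed.

Lemma holds_comp M N K (f : M -> N) (g : N -> K) (P : L)
    (t : (arity P).-tuple M) :
  holds K P (map_tuple (g \o f) t) = holds K P (map_tuple g (map_tuple f t)).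
Proof. by congr (holds K P _); apply: val_inj; rewrite /= map_comp. Qed.

Lemma embedding_comp M N K (f : M -> N) (g : N -> K) :
  embedding f -> embedding g -> embedding (g \o f).
Proof.
move=> [f_inj f_holds] [g_inj g_holds]; split; first exact: inj_comp.
by move=> P t; rewrite holds_comp g_holds f_holds.
Qed.

Lemma embedding_factor M N K (f : M -> N) (g : N -> K) :
  embedding g -> embedding (g \o f) -> embedding f.
Proof.
move=> [g_inj g_holds] [gf_inj gf_holds]; split; first exact: inj_compr gf_inj.
by move=> P t; rewrite -g_holds -holds_comp gf_holds.
Qed.

Lemma embedding_finfun M N (f : M -> N) :
  embedding ([ffun x => f x] : {ffun M -> N}) <-> embedding f.
Proof. by have -> : ([ffun x => f x] : M -> N) = f by apply: funext => x; rewrite ffunE. Qed.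

Lemma embedding_eq M N (f g : M -> N) : f =1 g -> embedding f -> embedding g.
Proof. by move=> /funext ->. Qed.

Lemma isomorphic_sym M N : isomorphic M N -> isomorphic N M.
Proof.
move=> [f [[g fK gK] f_emb]]; exists g; split; first by exists f.
apply: embedding_factor f_emb _.
by apply: embedding_eq (embedding_id N) => x /=; rewrite gK.
Qed.

Lemma isomorphic_card M N : isomorphic M N -> #|M| = #|N|.
Proof. by move=> [f [f_bij _]]; exact: bij_eq_card f_bij. Qed.

Lemma isomorphic_substructure M N : isomorphic M N -> substructure M N.
Proof. by move=> [f [_ ?]]; exists f. Qed.

Lemma empty_substructure M N : #|M| = 0%N -> substructure M N.
Proof.
move=> M0; have no_M (x : M) : False by have := card0_eq M0 x.
exists (fun x => False_rect _ (no_M x)); split=> [x|P t]; first by case: (no_M x).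
(* Arities are positive, so a tuple over an empty structure would have a first entry. *)
by case: (no_M (tnth t (Ordinal (arity_gt0 P)))).
Qed.

Lemma enum_val_embedding N (U : {set N}) :
  @embedding L (induced_on U) N (@enum_val N (mem U)).
Proof. by split=> //; exact: enum_val_inj. Qed.

Definition pullback_holds s N (w : 'I_s -> N) (P : L)
    (t : (arity P).-tuple 'I_s) : bool := holds N P (map_tuple w t).

Lemma pullback_holds_uniq s N (w : 'I_s -> N) (P : L)
    (t : (arity P).-tuple 'I_s) : pullback_holds w t -> uniq t.
Proof. by move=> /holds_uniq /map_uniq. Qed.

Definition pullback s N (w : 'I_s -> N) : fstruct L :=
  FStruct (@pullback_holds_uniq s N w).

Lemma pullback_embedding s N (w : 'I_s -> N) :
  injective w -> @embedding L (pullback w) N w.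
Proof. by split. Qed.

(** Codes make the labelled structures of size [s] finitely many, so that sums over all of them are
    available; [encode] then shows that there are countably many structures. *)
Definition code s : finType := {dffun forall P : L, {set (arity P).-tuple 'I_s}}.

Definition code_holds s (c : code s) (P : L) (t : (arity P).-tuple 'I_s) :=
  (t \in c P) && uniq t.

Lemma code_holds_uniq s (c : code s) (P : L) (t : (arity P).-tuple 'I_s) :
  code_holds c t -> uniq t.
Proof. by case/andP. Qed.

Definition of_code s (c : code s) : fstruct L := FStruct (@code_holds_uniq s c).

Definition to_code M : code (nvertices M) :=
  [ffun P : L => [set t | @holds L M P t]].

Lemma to_codeK M : of_code (to_code M) = M.
Proof.
case: M => s h hu; rewrite /of_code.
(* The proof of canonicity is generalised so that the predicate it depends on can be rewritten. *)
move: (@code_holds_uniq _ _).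
have -> : @code_holds s (to_code (FStruct hu)) = h.
  apply/functional_extensionality_dep => P; apply: funext => t.
  rewrite /code_holds ffunE inE /=.
  by case: (boolP (h P t)) => // /hu.
by move=> hu'; congr FStruct; exact: Prop_irrelevance.
Qed.

Definition encode M : {s : nat & code s} := Tagged code (to_code M).
Definition decode (c : {s : nat & code s}) : fstruct L := of_code (tagged c).

Lemma encodeK : cancel encode decode.
Proof. exact: to_codeK. Qed.

End Embeddings.

(** * Counting embeddings and copies *)

Section Counting.
Variable L : language.
Implicit Types M N K : fstruct L.

Definition embs M N : {set {ffun M -> N}} := finset (fun w : {ffun M -> N} => `[< embedding w >]).
Definition copies M N : {set {set N}} :=
  finset (fun U : {set N} => `[< isomorphic (induced_on U) M >]).

Lemma embsP M N (w : {ffun M -> N}) : reflect (embedding w) (w \in embs M N).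
Proof. by rewrite inE; exact: asboolP. Qed.

Lemma copiesP M N (U : {set N}) :
  reflect (isomorphic (induced_on U) M) (U \in copies M N).
Proof. by rewrite inE; exact: asboolP. Qed.

Lemma embedding_induced M N (U : {set N}) (w : M -> N) :
  embedding w -> (forall x, w x \in U) ->
  exists2 f : M -> induced_on U, embedding f &
    forall x, @enum_val N (mem U) (f x) = w x.
Proof.
move=> w_emb wU.
pose f : M -> induced_on U := fun x => enum_rank_in (wU x) (w x).
have fE x : @enum_val N (mem U) (f x) = w x by rewrite enum_rankK_in.
exists f => //; apply: embedding_factor (enum_val_embedding U) _.
by apply: embedding_eq w_emb => x /=; rewrite fE.
Qed.

Lemma card_induced N (U : {set N}) : #|induced_on U| = #|U|.
Proof. exact: card_ord. Qed.

Lemma image_copies M N (w : {ffun M -> N}) :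
  w \in embs M N -> w @: [set: M] \in copies M N.
Proof.
move=> /embsP w_emb; apply/copiesP/isomorphic_sym.
have [|f f_emb _] := embedding_induced w_emb (U := w @: [set: M]).
  by move=> x; apply: imset_f; rewrite inE.
exists f; split; last exact: f_emb.
apply: (inj_card_bij f_emb.1).
by rewrite card_induced card_imset ?cardsT //; exact: w_emb.1.
Qed.

(** Composition with a fixed isomorphism from [M] onto the copy turns the self-embeddings of [M]
    into the embeddings with image [U]. *)
Lemma card_embs_image M N (U : {set N}) : U \in copies M N ->
  #|[set w in embs M N | w @: [set: M] == U]| = #|embs M M|.
Proof.
move=> /copiesP /isomorphic_sym[f [f_bij f_emb]].
pose e x := @enum_val N (mem U) (f x).
have e_emb : embedding e := embedding_comp f_emb (enum_val_embedding U).
have [g fK gK] := f_bij.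
have eU x : e x \in U by exact: enum_valP.
have Ue y : y \in U -> exists x, e x = y.
  move=> yU; exists (g (enum_rank_in yU y)).
  by rewrite /e gK enum_rankK_in.
rewrite -(@card_in_imset _ _ (fun s : {ffun M -> M} => [ffun x => e (s x)])); last first.
  move=> s t _ _ /ffunP st; apply/ffunP => x.
  by have := st x; rewrite !ffunE => /e_emb.1.
apply: eq_card => w; rewrite inE; apply/andP/imsetP.
- move=> [/embsP w_emb /eqP wU].
  have /choice [s sE] : forall x, exists y, e y = w x.
    by move=> x; apply: Ue; rewrite -wU imset_f.
  exists (finfun s); last by apply/ffunP => x; rewrite !ffunE sE.
  apply/embsP/embedding_finfun; apply: embedding_factor e_emb _.
  by apply: embedding_eq w_emb => x; rewrite /= sE.
- move=> [s /embsP s_emb ->].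
  have es_emb : embedding ([ffun x => e (s x)] : {ffun M -> N}).
    by apply/embedding_finfun; exact: embedding_comp s_emb e_emb.
  split; first exact/embsP.
  rewrite eqEcard; apply/andP; split.
    by apply/fintype.subsetP => _ /imsetP[x _ ->]; rewrite ffunE.
  rewrite card_imset ?cardsT; last exact: es_emb.1.
  by rewrite (bij_eq_card f_bij) card_induced.
Qed.

(** Embeddings are grouped by their image. This trades copies for embeddings, which can be composed
    and restricted. *)
Lemma card_embs M N : #|embs M N| = (#|embs M M| * #|copies M N|)%N.
Proof.
rewrite -sum1_card (partition_big (fun w : {ffun M -> N} => w @: [set: M])
  (mem (copies M N))) /=; last first.
  by move=> w; exact: image_copies.
under eq_bigr => U UM.
  rewrite sum1dep_card.
  rewrite (_ : #|_| = #|embs M M|); last exact: card_embs_image.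
  over.
by rewrite sum_nat_const mulnC.
Qed.

Lemma embs_id_gt0 M : (0 < #|embs M M|)%N.
Proof.
apply/card_gt0P; exists [ffun x => x]; apply/embsP/embedding_finfun.
exact: embedding_id.
Qed.

Lemma card_embs_comp M N K : substructure N K -> (#|embs M N| <= #|embs M K|)%N.
Proof.
move=> [e e_emb].
rewrite -(@card_in_imset _ _ (fun s : {ffun M -> N} => [ffun x => e (s x)])); last first.
  move=> s t _ _ /ffunP st; apply/ffunP => x.
  by have := st x; rewrite !ffunE => /e_emb.1.
apply/subset_leq_card/fintype.subsetP => _ /imsetP[s /embsP s_emb ->].
by apply/embsP/embedding_finfun; exact: embedding_comp s_emb e_emb.
Qed.

(** A map on [T] is determined by its restriction along [j] and its values off the image of [j]. *)
Lemma card_ffun_comp_le (S T U : finType) (j : S -> T)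
    (P : {set {ffun S -> U}}) : injective j ->
  (#|finset (fun w : {ffun T -> U} => [ffun x => w (j x)] \in P)|
     <= #|P| * #|U| ^ (#|T| - #|S|))%N.
Proof.
move=> j_inj.
pose C := {y : T | y \notin codom j}.
pose Phi (w : {ffun T -> U}) : {ffun S -> U} * {ffun C -> U} :=
  ([ffun x => w (j x)], [ffun y => w (val y)]).
have Phi_inj : injective Phi.
  move=> w w' [/ffunP e1 /ffunP e2]; apply/ffunP => y.
  case: (boolP (y \in codom j)) => [/codomP[x ->]|yj].
    by have := e1 x; rewrite !ffunE.
  by have := e2 (exist _ y yj); rewrite !ffunE.
have -> : (#|T| - #|S|)%N = #|{: C}|.
  rewrite card_sig -(card_codom j_inj) -(cardC (mem (codom j))) addKn.
  by apply: eq_card => y; rewrite !inE.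
rewrite -card_ffun -[X in (_ <= _ * X)%N]cardsT -cardsX -(card_imset _ Phi_inj).
apply/subset_leq_card/fintype.subsetP => _ /imsetP[w wP ->].
by rewrite !inE /= andbT; rewrite inE in wP.
Qed.

Lemma card_embs_substructure M N K : substructure M N ->
  (#|embs N K| <= #|embs M K| * #|K| ^ (#|N| - #|M|))%N.
Proof.
move=> [j j_emb]; apply: leq_trans (card_ffun_comp_le (embs M K) j_emb.1).
apply/subset_leq_card/fintype.subsetP => w /embsP w_emb; rewrite inE.
by apply/embsP/embedding_finfun; exact: embedding_comp j_emb w_emb.
Qed.

(* [of_code] is not injective: codes containing non-injective tuples are
   junk, and exactly the others satisfy [canonical_code]. *)
Definition canonical_code s (c : code L s) := to_code (of_code c) == c.

Lemma to_code_canonical M : canonical_code (to_code M).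
Proof.
apply/eqP/ffunP => P; apply/setP => t; rewrite !ffunE !inE /= /code_holds ffunE inE.
by case: (boolP (holds M P t)) => // /holds_uniq.
Qed.

Lemma embs_of_code s N (c : code L s) (w : {ffun 'I_s -> N}) :
  canonical_code c ->
  (w \in embs (of_code c) N) = injectiveb w && (to_code (pullback w) == c).
Proof.
move=> c_can; apply/embsP/andP => [w_emb|[/injectiveP w_inj /eqP wc]].
  split; first exact/injectiveP/(w_emb.1).
  rewrite -(eqP c_can); apply/eqP/ffunP => P; apply/setP => t.
  by rewrite !ffunE !inE -w_emb.2.
split=> // P t; rewrite /= /code_holds -wc ffunE inE /=.
move: (@pullback_holds_uniq _ _ _ w P t); rewrite /pullback_holds.
by case: (holds N P _) => // ->.
Qed.

(** Grouping the samples by the code of the sampled structure leaves a finite combination of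
    embedding counts, which is why a limit determines averages over samples. *)
Lemma sum_injective_pullback (R : pzSemiRingType) s N (G : fstruct L -> R) :
  \sum_(w : {ffun 'I_s -> N} | injectiveb w) G (pullback w) =
  \sum_(c : code L s | canonical_code c)
    G (of_code c) * #|embs (of_code c) N|%:R.
Proof.
rewrite (partition_big (fun w : {ffun 'I_s -> N} => to_code (pullback w) : code L s)
   (@canonical_code s)) /=; last by move=> w _; exact: (to_code_canonical (pullback w)).
apply: eq_bigr => c c_can.
rewrite -sum1_card natr_sum mulr_sumr; apply: eq_big => w.
  by rewrite -embs_of_code.
by move=> /andP[_ /eqP <-]; rewrite mulr1 (to_codeK (pullback w)).
Qed.

End Counting.

(** * Densities in convergent sequences *)

Section Densities.
Variables (L : language) (R : realType).
Implicit Types (M N : fstruct L) (phi psi : fstruct L -> R).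
Local Open Scope classical_set_scope.

Lemma homo_ltn_ge (a : nat -> nat) :
  {homo a : m n / (m < n)%N} -> forall n, (n <= a n)%N.
Proof. by move=> a_incr; elim=> // n IHn; apply: leq_ltn_trans IHn (a_incr _ _ _). Qed.

Lemma near_cvg (f g : nat -> R) (l : R) :
  (\forall n \near \oo, f n = g n) -> f n @[n --> \oo] --> l ->
  g n @[n --> \oo] --> l.
Proof. by move=> fg fl; apply: (cvg_trans (near_eq_cvg fg) fl). Qed.

Lemma cvg_sum_seq (I : Type) (r : seq I) (P : pred I) (F : I -> nat -> R)
    (l : I -> R) : (forall i, P i -> F i n @[n --> \oo] --> l i) ->
  \sum_(i <- r | P i) F i n @[n --> \oo] --> \sum_(i <- r | P i) l i.
Proof.
move=> F_cvg; elim: r => [|i r IHr].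
  by rewrite big_nil; under eq_fun do rewrite big_nil; exact: cvg_cst.
rewrite big_cons; under eq_fun do rewrite big_cons.
by case: ifP => // Pi; apply: cvgD => //; exact: F_cvg.
Qed.

Lemma cvg_inv_nat (a : nat -> nat) :
  (forall n, (n <= a n)%N) -> ((a n)%:R^-1 : R) @[n --> \oo] --> (0 : R).
Proof.
move=> a_ge; apply/(@gtr0_cvgV0 R nat \oo%classic _ (fun n => (a n)%:R)).
  near=> n; rewrite ltr0n; apply: leq_trans (a_ge n).
  by near: n; exists 1%N.
apply: (@ger_cvgy _ _ _ R (fun n => n%:R)); last exact: cvgr_idn.
by near=> n; rewrite ler_nat.
Unshelve. all: by end_near. Qed.

Lemma ffact_cvg (a : nat -> nat) m : (forall n, (n <= a n)%N) ->
  ((a n ^_ m)%:R / (a n)%:R ^+ m : R) @[n --> \oo] --> (1 : R).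
Proof.
move=> a_ge; elim: m => [|m IHm].
  by under eq_fun do rewrite ffactn0 expr0 divr1; exact: cvg_cst.
have cm : (1 - m%:R * (a n)%:R^-1 : R) @[n --> \oo] --> (1 : R).
  rewrite -[X in _ --> X]subr0 -[X in _ --> _ - X](mulr0 m%:R).
  by apply: cvgB; [exact: cvg_cst | apply: cvgMl_tmp; exact: cvg_inv_nat].
have c : ((a n ^_ m)%:R / (a n)%:R ^+ m * (1 - m%:R * (a n)%:R^-1) : R)
    @[n --> \oo] --> (1 * 1 : R) by exact: (cvgM IHm cm).
rewrite mulr1 in c; apply: near_cvg c.
near=> n.
have am : (m < a n)%N by apply: leq_trans (a_ge n); near: n; exists m.+1.
have a0 : (a n)%:R != 0 :> R by rewrite pnatr_eq0 -lt0n (leq_trans _ am).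
rewrite ffactnSr natrM natrB ?(ltnW am) // exprSr invfM mulrACA mulrBl divff //.
Unshelve. all: by end_near. Qed.



(** The quotient is the proportion of non-injective maps from ['I_s] to a set of size [a n]. *)
Lemma ninjective_cvg (a : nat -> nat) s : (forall n, (n <= a n)%N) ->
  ((a n ^ s - a n ^_ s)%:R / (a n)%:R ^+ s : R) @[n --> \oo] --> (0 : R).
Proof.
move=> a_ge.
have c : (1 - (a n ^_ s)%:R / (a n)%:R ^+ s : R) @[n --> \oo] --> (1 - 1 : R).
  by apply: cvgB; [exact: cvg_cst | exact: ffact_cvg].
rewrite subrr in c; apply: near_cvg c.
near=> n.
have a0 : (a n)%:R != 0 :> R.
  rewrite pnatr_eq0 -lt0n; apply: leq_trans (a_ge n).
  by near: n; exists 1%N.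
rewrite natrB ?natrX ?mulrBl ?divff ?expf_neq0 //.
(* What is left is the side condition of [natrB]: a falling factorial is at most the power. *)
elim: s {a_ge} => // s IHs; rewrite ffactnSr expnSr.
by apply: leq_mul => //; exact: leq_subr.
Unshelve. all: by end_near. Qed.

(** All maps are counted in the denominator, injective or not, so that powers take the place of
    binomials. *)
Definition emb_density M N : R := #|embs M N|%:R / #|N|%:R ^+ #|M|.

(** A set of size [#|M|] is the image of [#|M|!] injections, and a copy of [M] is the image of
    [#|embs M M|] embeddings. *)
Definition emb_limit psi M : R := #|embs M M|%:R * psi M / ((#|M|)`!)%:R.

Lemma card_copies M N :
  #|[pred U : {set N} | `[< isomorphic (induced_on U) M >]]| = #|copies M N|.
Proof. by apply: eq_card => U; rewrite !inE. Qed.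

Lemma card_embs_density M N :
  #|embs M N|%:R = #|embs M M|%:R * density R M N * 'C(#|N|, #|M|)%:R :> R.
Proof.
rewrite card_embs natrM -mulrA; congr (_ * _).
rewrite /density card_copies; have [NM|MN] := ltnP #|N| #|M|; last first.
  by rewrite divfK // pnatr_eq0 -lt0n bin_gt0.
(* Here the binomial is 0 and cannot be cancelled, but [N] is too small to contain a copy. *)
rewrite bin_small // mulr0; apply/eqP; rewrite pnatr_eq0 cards_eq0.
apply/eqP/setP => U; rewrite finset.in_set0; apply/negbTE/negP => /copiesP /isomorphic_card.
move=> U_card; have := max_card (mem U); rewrite -card_induced U_card.
by rewrite leqNgt NM.
Qed.

Lemma emb_densityE M N :
  emb_density M N = #|embs M M|%:R / ((#|M|)`!)%:R * density R M N *
    ((#|N| ^_ #|M|)%:R / #|N|%:R ^+ #|M|).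
Proof.
rewrite /emb_density card_embs_density -bin_ffact natrM.
have f0 : ((#|M|)`!)%:R != 0 :> R by rewrite pnatr_eq0 -lt0n fact_gt0.
have fV := divff f0; move: fV.
set x := #|embs M M|%:R; set y := density R M N; set z := 'C(_, _)%:R.
set u := (_ `!)%:R; set u' := u^-1; set v := (_ ^+ _)^-1 => fV.
by rewrite -[LHS]mulr1 -fV; lra.
Qed.

Lemma converges_to_ge S phi : converges_to S phi -> forall n, (n <= #|S n|)%N.
Proof. by move=> [S_incr _]; exact: homo_ltn_ge. Qed.

Lemma emb_density_cvg S phi M : converges_to S phi ->
  emb_density M (S n) @[n --> \oo] --> emb_limit phi M.
Proof.
move=> S_phi; under eq_fun do rewrite emb_densityE.
have -> : emb_limit phi M = #|embs M M|%:R / ((#|M|)`!)%:R * phi M * 1.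
  by rewrite mulr1 /emb_limit mulrAC.
apply: cvgM; last exact: ffact_cvg (converges_to_ge S_phi).
by apply: cvgMl_tmp; exact: S_phi.2.
Qed.

Lemma emb_limit_gt0 psi M : (0 < emb_limit psi M) = (0 < psi M).
Proof.
by rewrite /emb_limit pmulr_lgt0 ?invr_gt0 ?ltr0n ?fact_gt0 // pmulr_rgt0 // ltr0n embs_id_gt0.
Qed.

Lemma limit_gt0P S psi M : converges_to S psi ->
  0 < psi M <-> exists2 e : R, 0 < e &
    \forall n \near \oo, e <= emb_density M (S n).
Proof.
move=> S_psi; have S_cvg := @emb_density_cvg _ _ M S_psi.
rewrite -emb_limit_gt0; split=> [psi_gt0|[e e_gt0 S_ge]].
  exists (emb_limit psi M / 2); first by rewrite divr_gt0.
  apply: (cvgr_ge _ S_cvg).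
  by rewrite ltr_pdivrMr // ltr_pMr // ltr1n.
by apply: lt_le_trans e_gt0 _; exact: (cvgr_to_ge S_cvg).
Qed.

(** Restricting a random map [N -> K] along [M -> N] gives a random map [M -> K], and embeddings
    restrict to embeddings. *)
Lemma emb_density_substructure M N K : substructure M N ->
  emb_density N K <= emb_density M K.
Proof.
move=> MN; have [j [j_inj _]] := MN.
have MNc : (#|M| <= #|N|)%N by exact: leq_card j_inj.
have := card_embs_substructure K MN; rewrite /emb_density.
(* For empty [K] the left side is a division by 0, hence 0, unless [N] is empty, in which case [M]
   is empty too. *)
have [->|K0] := posnP #|K|.
  have [N0|N0] := posnP #|N|; last by rewrite expr0n gtn_eqF // invr0 mulr0 divr_ge0 ?exprn_ge0.
  have M0 : #|M| = 0%N by apply/eqP; rewrite -leqn0 -N0.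
  by rewrite N0 M0 subn0 expn0 muln1 expr0 !divr1 ler_nat.
rewrite -(@ler_nat R) natrM natrX => le.
have K0R : 0 < #|K|%:R :> R by rewrite ltr0n.
rewrite ler_pdivrMr ?exprn_gt0 //; apply: le_trans le _.
have -> : #|K|%:R ^+ #|N| = #|K|%:R ^+ #|M| * #|K|%:R ^+ (#|N| - #|M|) :> R.
  by rewrite -exprD subnKC.
by rewrite mulrA divfK // expf_neq0 // gt_eqF.
Qed.

Lemma limit_substructure phi M N : is_limit phi -> substructure M N ->
  0 < phi N -> 0 < phi M.
Proof.
move=> [S S_phi] MN /(limit_gt0P N S_phi)[e e_gt0 S_ge].
apply/(limit_gt0P M S_phi); exists e => //.
by apply: filterS S_ge => n /le_trans; apply; exact: emb_density_substructure.
Qed.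

Lemma density_isomorphic M N N' : isomorphic N N' ->
  density R M N = density R M N'.
Proof.
move=> NN'; rewrite /density !card_copies (isomorphic_card NN'); congr (_%:R / _).
apply/eqP; rewrite -(eqn_pmul2l (embs_id_gt0 M)) -!card_embs eqn_leq.
by rewrite !card_embs_comp //; apply: isomorphic_substructure => //; exact: isomorphic_sym.
Qed.

Lemma induced_setT N : isomorphic (induced_on [set: N]%SET) N.
Proof.
exists (@enum_val N (mem [set: N]%SET)); split; last exact: enum_val_embedding.
apply: inj_card_bij; first exact: enum_val_inj.
by rewrite card_induced cardsT.
Qed.

Lemma sub_object_refl phi : is_limit phi -> sub_object phi phi.
Proof.
move=> [S S_phi]; exists S, (fun n => [set: S n]%SET), 1; split => //.
  apply: cvg_near_cst; near=> n; rewrite cardsT divff // pnatr_eq0 -lt0n.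
  by apply: leq_trans (converges_to_ge S_phi n); near: n; exists 1%N.
split; first by move=> m n mn; rewrite !card_induced !cardsT; exact: S_phi.1.
move=> M; under eq_fun do rewrite (density_isomorphic M (induced_setT _)).
exact: S_phi.2.
Unshelve. all: by end_near. Qed.

Lemma sub_object_limit psi phi : sub_object psi phi -> is_limit psi.
Proof. by move=> [S [A [c [_ _ _ ?]]]]; eexists; eassumption. Qed.

Lemma Pset_sub_Qset phi : is_limit phi -> Pset phi `<=` Qset phi.
Proof. by move=> phi_lim M; apply; exact: sub_object_refl. Qed.

(** The limit of the averages depends on [phi] alone. This carries a bound from one sequence
    converging to [phi] over to any other. *)
Lemma sum_injective_pullback_cvg S phi s (G : fstruct L -> R) :
  converges_to S phi ->
  (\sum_(w : {ffun 'I_s -> S n} | injectiveb w) G (pullback w)) / #|S n|%:R ^+ s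
    @[n --> \oo] -->
  \sum_(c : code L s | canonical_code c) G (of_code c) * emb_limit phi (of_code c).
Proof.
move=> S_phi; under eq_fun do rewrite sum_injective_pullback mulr_suml.
apply: cvg_sum_seq => c _; rewrite /= in c *.
have -> : (fun n => G (of_code c) * #|embs (of_code c) (S n)|%:R / #|S n|%:R ^+ s) =
    (fun n => G (of_code c) * emb_density (of_code c) (S n)).
  by apply: funext => n; rewrite /emb_density [#|of_code c|]card_ord mulrA.
by apply: cvgMl_tmp; exact: emb_density_cvg.
Qed.

End Densities.

(** * Compactness *)

Section Compactness.
Variables (R : realType).
Local Open Scope classical_set_scope.

Lemma homo_ltn_comp (g h : nat -> nat) : {homo g : m n / (m < n)%N} ->
  {homo h : m n / (m < n)%N} -> {homo g \o h : m n / (m < n)%N}.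
Proof. by move=> g_incr h_incr m n mn /=; apply/g_incr/h_incr. Qed.

Lemma cvg_subsequence (h : nat -> nat) (x : nat -> R) (l : R) :
  {homo h : m n / (m < n)%N} ->
  x n @[n --> \oo] --> l -> x (h n) @[n --> \oo] --> l.
Proof.
move=> h_incr; apply: cvg_comp => A [N _ NA].
exists N => // n /= Nn; apply: NA => /=.
by apply: leq_trans Nn _; exact: homo_ltn_ge.
Qed.

Lemma increasing_subsequence (a : nat -> nat) : (forall n, (n <= a n)%N) ->
  exists2 h : nat -> nat, {homo h : m n / (m < n)%N} &
    {homo a \o h : m n / (m < n)%N}.
Proof.
move=> a_ge; pose h := fix h k := if k is j.+1 then (maxn (h j) (a (h j))).+1 else 0%N.
exists h; apply: (homo_ltn ltn_trans) => k /=; first by rewrite ltnS leq_maxl.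
by apply: leq_trans (a_ge _); rewrite ltnS leq_maxr.
Qed.

(** Tychonoff's theorem yields a cluster point; as the coordinates are countable, a diagonal choice
    of indices yields a subsequence. *)
Lemma cube_sequentially_compact (T : countType) (u : nat -> T -> R) :
  (forall n t, 0 <= u n t <= 1) ->
  exists2 h : nat -> nat, {homo h : m n / (m < n)%N} &
    exists l : T -> R, forall t, u (h n) t @[n --> \oo] --> l t.
Proof.
move=> u01.
have [] := @tychonoff T (fun=> R) (fun=> `[0, 1]%classic) (fun=> @segment_compact R 0 1)
  (u n @[n --> \oo]) _.
  by exists 0%N => // n _ t /=; rewrite in_itv /= u01.
move=> l [_ l_cluster].
have nbhs_l (r : seq T) (e : R) : 0 < e ->
    nbhs l [set f | forall t, t \in r -> `|l t - f t| < e].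
  move=> e_gt0; elim: r => [|t r IHr]; first by apply: filterS filterT => f _ t.
  have lt : nbhs l [set f | `|l t - f t| < e].
    exact: (@proj_continuous T (fun _ => R) t l _ (nbhsx_ballx (l t) e e_gt0)).
  apply: filterS (filterI lt IHr) => f [f_t f_r] s; rewrite inE => /orP[/eqP->//|].
  exact: f_r.
(* Given [(k, n0)], an index beyond [n0] is chosen at which the coordinates numbered below [k] are
   within [1/(k+1)] of the cluster point. *)
have /choice[g gP] : forall kn : nat * nat, exists n, (kn.2 < n)%N /\
    forall t, (pickle t < kn.1)%N -> `|l t - u n t| < kn.1.+1%:R^-1.
  move=> [k n0] /=.
  have [||f [[n] [n0n <-]] fP] := l_cluster (u @` [set n | (n0 < n)%N])
    [set f | forall t, t \in pmap unpickle (iota 0 k) -> `|l t - f t| < k.+1%:R^-1].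
  - by exists n0.+1 => // n /= n0n; exists n.
  - by apply: nbhs_l; rewrite invr_gt0.
  exists n; split => // t tk; apply: fP; rewrite mem_pmap.
  by apply/mapP; exists (pickle t); rewrite ?mem_iota ?pickleK.
pose h := fix h k := if k is j.+1 then g (k, h j) else g (0, 0)%N.
exists h; first by apply: (homo_ltn ltn_trans) => k /=; have [] := gP (k.+1, h k).
exists l => t; apply/cvgrPdist_lt => e e_gt0.
have hP n : (pickle t < n)%N -> `|l t - u (h n) t| < n.+1%:R^-1.
  by case: n => // n tn; have [_] := gP (n.+1, h n); apply.
near=> n; apply: lt_trans (hP n _) _; first by near: n; exists (pickle t).+1.
near: n.
have [N _ NP] := near_infty_natSinv_lt (PosNum e_gt0).
by exists N => // n /NP.
Unshelve. all: by end_near. Qed.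

End Compactness.

Section StructureCompactness.
Variables (L : language) (R : realType).
Local Open Scope classical_set_scope.

Lemma density_in01 (M N : fstruct L) : 0 <= density R M N <= 1.
Proof.
rewrite /density card_copies divr_ge0 //=.
have le : (#|copies M N| <= 'C(#|N|, #|M|))%N.
  rewrite -card_draws; apply/subset_leq_card/fintype.subsetP => U /copiesP UM.
  by rewrite inE -card_induced (isomorphic_card UM).
have [C0|C0] := posnP 'C(#|N|, #|M|); first by rewrite C0 invr0 mulr0.
by rewrite ler_pdivrMr ?ltr0n // mul1r ler_nat.
Qed.

(** The densities of all structures are coordinates of a point in a cube, and [x] is one more
    coordinate, [None]. In [Pset_uniform] it carries the relative sizes of the chosen vertex
    sets. *)
Lemma convergent_subsequence (S : nat -> fstruct L) (x : nat -> R) :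
  (forall n, (n <= #|S n|)%N) -> (forall n, 0 <= x n <= 1) ->
  exists h : nat -> nat, {homo h : m n / (m < n)%N} /\
    exists (phi : fstruct L -> R) (c : R),
      converges_to (S \o h) phi /\ x (h n) @[n --> \oo] --> c.
Proof.
move=> S_ge x01; have [g g_incr Sg_incr] := increasing_subsequence S_ge.
pose u n (t : option {s : nat & code L s}) :=
  if t is Some t' then density R (decode t') (S (g n)) else x (g n).
have [|h h_incr [l u_cvg]] := @cube_sequentially_compact R _ u.
  by move=> n [t|] //=; exact: density_in01.
exists (g \o h); split; first exact: homo_ltn_comp.
exists (fun M => l (Some (encode M))), (l None); split; last exact: (u_cvg None).
split; first by move=> m n mn; exact/Sg_incr/h_incr.
by move=> M; have := u_cvg (Some (encode M)); rewrite /= encodeK.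
Qed.

End StructureCompactness.

(** * Counting substitutions *)

Section Substitutions.
Variables (L : language) (R : realType).
Implicit Types M N K : fstruct L.

(** These stand for the embeddings of [M] in [induced_on B], without its relabelling of the
    vertices. *)
Definition embs_into M N (B : {set N}) : {set {ffun M -> N}} :=
  finset (fun w : {ffun M -> N} => (w \in embs M N) && [forall x, w x \in B]).

Lemma embs_intoP M N (B : {set N}) (w : {ffun M -> N}) :
  reflect (embedding w /\ forall x, w x \in B) (w \in embs_into M B).
Proof.
rewrite inE; apply: (iffP andP) => [[/embsP ? /forallP ?]|[? ?]] //.
by split; [exact/embsP | exact/forallP].
Qed.

Lemma card_embs_induced M N (B : {set N}) :
  #|embs M (induced_on B)| = #|embs_into M B|.
Proof.
pose ev := @enum_val N (mem B) : induced_on B -> N.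
rewrite -(@card_in_imset _ _
  (fun s : {ffun M -> induced_on B} => [ffun x => ev (s x)])); last first.
  move=> s t _ _ /ffunP st; apply/ffunP => x.
  by have := st x; rewrite !ffunE => /enum_val_inj.
apply: eq_card => w; apply/imsetP/embs_intoP => [[s /embsP s_emb ->]|[w_emb wB]].
  split; last by move=> x; rewrite ffunE; exact: enum_valP.
  by apply/embedding_finfun; exact: embedding_comp s_emb (enum_val_embedding B).
have [f f_emb fE] := embedding_induced w_emb wB.
exists [ffun x => f x]; first exact/embsP/embedding_finfun.
by apply/ffunP => x; rewrite !ffunE [RHS]fE.
Qed.

Lemma extend_at (F1 : fstruct L) (v : F1) (T : Type) (r : {x : F1 | x != v} -> T) w :
  extend r w v = w.
Proof. by rewrite /extend; case: insubP => // x; rewrite eqxx. Qed.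

Lemma extend_off (F1 : fstruct L) (v : F1) (T : Type) (r : {x : F1 | x != v} -> T) w
    (x : {x : F1 | x != v}) : extend r w (val x) = r x.
Proof. by rewrite /extend valK. Qed.

Lemma extend_spec (F1 : fstruct L) (v : F1) (T : Type) (r : {x : F1 | x != v} -> T) w
    (x : F1) :
  x = v /\ extend r w x = w \/
  exists2 y : {x : F1 | x != v}, x = val y & extend r w x = r y.
Proof.
have [->|xv] := eqVneq x v; first by left; rewrite extend_at.
right; exists (exist (fun x : F1 => x != v) x xv) => //.
exact: (extend_off r w (exist (fun x : F1 => x != v) x xv)).
Qed.

Lemma substitution_disjoint (F1 F2 K : fstruct L) (v : F1)
    (f1 : {x : F1 | x != v} -> K) (f2 : F2 -> K) (u0 : F2) :
  (forall u, embedding (extend f1 (f2 u))) ->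
  injective f1 /\ forall x u, f1 x <> f2 u.
Proof.
move=> ext_emb; split=> [x y fE|x u fE].
  by apply: val_inj; apply: (ext_emb u0).1; rewrite !extend_off.
have /(ext_emb u).1 vx : extend f1 (f2 u) (val x) = extend f1 (f2 u) v.
  by rewrite extend_off extend_at.
by have := valP x; rewrite vx eqxx.
Qed.

Section Count.
Variables (F1 F2 N : fstruct L) (v : F1) (A : {set N}).
Let X : finType := {x : F1 | x != v}.
Let Z : finType := (X + F2)%type.

Definition extensions (r : {ffun X -> N}) : {set N} :=
  finset (fun w : N => [ffun x => extend r w x] \in embs_into F1 A).

(** An embedding of [F1] is determined by its restriction [r] to [F1 - v] and by the image of [v],
    which is an extension of [r]. *)
Lemma card_embs_into_extensions :
  (#|embs_into F1 A| <= \sum_(r : {ffun X -> N}) #|extensions r|)%N.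
Proof.
pose restr (f : {ffun F1 -> N}) : {ffun X -> N} := [ffun x => f (val x)].
rewrite -sum1_card (partition_big restr predT) //=; apply: leq_sum => r _.
rewrite sum1dep_card.
have fE (f : {ffun F1 -> N}) : restr f = r -> f = [ffun x => extend r (f v) x].
  move=> /ffunP fr; apply/ffunP => x; rewrite ffunE.
  have [[-> ->] //|[y -> ->]] := extend_spec r (f v) x.
  by have := fr y; rewrite ffunE.
rewrite -(@card_in_imset _ _ (fun f : {ffun F1 -> N} => f v)); last first.
  move=> f g; rewrite !inE => /andP[_ /eqP /fE ef] /andP[_ /eqP /fE eg] fg.
  by rewrite ef eg fg.
apply/subset_leq_card/fintype.subsetP => w /imsetP[f]; rewrite inE => /andP[fA /eqP fr] ->.
by rewrite inE -(fE f).
Qed.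

(** The domain is the vertex set of a future substitution, the disjoint union of [F1 - v] and [F2],
    numbered because vertices of structures are ordinals. *)
Definition glue (r : {ffun X -> N}) (g : {ffun F2 -> N}) : {ffun 'I_#|Z| -> N} :=
  [ffun i => match enum_val i with inl x => r x | inr u => g u end].

Definition glue_left (x : X) : 'I_#|Z| := enum_rank (inl x : Z).
Definition glue_right (u : F2) : 'I_#|Z| := enum_rank (inr u : Z).

Lemma glue_leftE r g x : glue r g (glue_left x) = r x.
Proof. by rewrite ffunE enum_rankK. Qed.

Lemma glue_rightE r g u : glue r g (glue_right u) = g u.
Proof. by rewrite ffunE enum_rankK. Qed.

Lemma glue_spec (i : 'I_#|Z|) :
  (exists x, i = glue_left x) \/ (exists u, i = glue_right u).
Proof.
rewrite -[i]enum_valK; case: (enum_val i) => [x|u]; [left; exists x|right; exists u]; done.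
Qed.

(** As each [g u] extends [r], each [u] in [F2] can play the role of [v]. An existing extension
    makes [r] injective with values in [A] even when [F2] is empty. *)
Lemma glue_substitution r g : (0 < #|extensions r|)%N ->
    g \in embs_into F2 (extensions r) ->
  [/\ injective (glue r g), forall i, glue r g i \in A &
      substitution v F2 (pullback (glue r g))].
Proof.
move=> /card_gt0P[w0]; rewrite inE => /embs_intoP[r0_emb r0A].
move=> /embs_intoP[g_emb gB].
have ext_emb u : embedding (extend r (g u)).
  by have := gB u; rewrite inE => /embs_intoP[/embedding_finfun].
have r_inj : injective r.
  move=> x y rxy; apply: val_inj; apply: r0_emb.1.
  by rewrite !ffunE !extend_off.
have r_g x u : r x <> g u.
  move=> rg; have /(ext_emb u).1 vx : extend r (g u) (val x) = extend r (g u) v.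
    by rewrite extend_off extend_at.
  by have := valP x; rewrite vx eqxx.
have h_inj : injective (glue r g).
  move=> i j; have [[x ->]|[x ->]] := glue_spec i; have [[y ->]|[y ->]] := glue_spec j;
    rewrite ?glue_leftE ?glue_rightE.
  - by move=> /r_inj ->.
  - by move=> /r_g.
  - by move=> /esym /r_g.
  - by move=> /g_emb.1 ->.
have h_emb := pullback_embedding h_inj.
split=> // [i|].
  have [[x ->]|[u ->]] := glue_spec i; rewrite ?glue_leftE ?glue_rightE.
    by have := r0A (val x); rewrite ffunE extend_off.
  have := gB u; rewrite inE => /embs_intoP[_ /(_ v)].
  by rewrite ffunE extend_at.
exists glue_left, glue_right; split.
- apply/seteqP; split => // i _.
  by have [[x ->]|[u ->]] := glue_spec i; [left; exists x | right; exists u].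
- apply: embedding_factor h_emb _.
  by apply: embedding_eq g_emb => u /=; rewrite glue_rightE.
- move=> u; apply: embedding_factor h_emb _.
  apply: embedding_eq (ext_emb u) => x /=.
  have [[-> ->]|[y -> ->]] := extend_spec r (g u) x.
    by rewrite extend_at glue_rightE.
  by rewrite extend_off glue_leftE.
Qed.

Definition substitution_code (c : code L #|Z|) : bool :=
  canonical_code c && `[< substitution v F2 (of_code c) >].

(** Gluing is injective on pairs [(r, g)], and the glued maps are sorted by the code of the
    structure that they pull back. *)
Lemma card_glue (P : {set {ffun X -> N}}) :
    (forall r, r \in P -> (0 < #|extensions r|)%N) ->
  (\sum_(r in P) #|embs_into F2 (extensions r)| <=
   \sum_(c | substitution_code c) #|embs_into (of_code c) A|)%N.
Proof.
move=> P_ext.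
pose D := finset (fun p : {ffun X -> N} * {ffun F2 -> N} =>
  (p.1 \in P) && (p.2 \in embs_into F2 (extensions p.1))).
have -> : (\sum_(r in P) #|embs_into F2 (extensions r)| = #|D|)%N.
  rewrite -sum1_card; under eq_bigr do rewrite -sum1_card.
  by rewrite pair_big_dep /=; apply: eq_bigl => p; rewrite !inE.
pose cd (p : {ffun X -> N} * {ffun F2 -> N}) : code L #|Z| :=
  to_code (pullback (glue p.1 p.2)).
rewrite -sum1_card (partition_big cd substitution_code) /=; last first.
  move=> [r g]; rewrite inE /= => /andP[rP gr].
  have [_ _ sub] := glue_substitution (P_ext r rP) gr.
  apply/andP; split; first exact: (to_code_canonical (pullback _)).
  by apply/asboolP; rewrite /cd (to_codeK (pullback _)).
apply: leq_sum => c /andP[c_can _]; rewrite sum1dep_card.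
rewrite -(@card_in_imset _ _ (fun p => glue p.1 p.2)); last first.
  move=> [r g] [r' g'] _ _ /ffunP /= e; congr (_, _); apply/ffunP => x.
    by have := e (glue_left x); rewrite !glue_leftE.
  by have := e (glue_right x); rewrite !glue_rightE.
apply/subset_leq_card/fintype.subsetP => w /imsetP[[r g] /=].
rewrite 2!inE /= => /andP[/andP[rP gr] /eqP cE] ->; rewrite inE.
have [h_inj hA _] := glue_substitution (P_ext r rP) gr.
rewrite embs_of_code // -cE eqxx andbT.
by apply/andP; split; [exact/injectiveP | exact/forallP].
Qed.

(* At least [a/2 * |N|^(|F1|-1)] maps [r] have at least [a/2 * |N|] extensions,
   for otherwise there would be too few embeddings of [F1]. *)
Lemma card_substitutions (a e : R) : (0 < #|N|)%N -> 0 < a ->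
    a * #|N|%:R ^+ #|F1| <= #|embs_into F1 A|%:R ->
    0 <= e ->
    (forall B : {set N}, a / 2 * #|N|%:R <= #|B|%:R ->
      e * #|N|%:R ^+ #|F2| <= #|embs_into F2 B|%:R) ->
  a / 2 * e * #|N|%:R ^+ #|Z| <=
    \sum_(c | substitution_code c) #|embs_into (of_code c) A|%:R.
Proof.
move=> N0 a_gt0 F1_ge e_ge0 F2_ge.
set n : R := #|N|%:R in F1_ge F2_ge *.
have n_gt0 : 0 < n by rewrite ltr0n.
pose P := finset (fun r : {ffun X -> N} => a / 2 * n <= #|extensions r|%:R).
have P_ext r : r \in P -> (0 < #|extensions r|)%N.
  rewrite inE -(@ltr0n R); apply: lt_le_trans.
  by rewrite mulr_gt0 // divr_gt0.
have FX : #|F1| = #|X|.+1.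
  by rewrite card_sig -(cardC (pred1 v)) card1 add1n.
have P_ge : a / 2 * n ^+ #|X| <= #|P|%:R.
  rewrite -(ler_pM2r n_gt0).
  (* Each [r] in [P] accounts for at most [n] embeddings, and each of the at most [n ^+ #|X|] others
     for at most [a / 2 * n]. *)
  have le : a * n ^+ #|F1| <= #|P|%:R * n + n ^+ #|X| * (a / 2 * n).
    apply: le_trans F1_ge _.
    have := card_embs_into_extensions; rewrite -(ler_nat R) => /le_trans; apply.
    rewrite natr_sum (bigID (mem P)) /=; apply: lerD.
      apply: (@le_trans _ _ (\sum_(r in P) n)).
        by apply: ler_sum => r _; rewrite ler_nat max_card.
      by rewrite sumr_const mulr_natl.
    apply: (@le_trans _ _ (\sum_(r | r \notin P) (a / 2 * n))).
      by apply: ler_sum => r; rewrite inE -ltNge => /ltW.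
    apply: (@le_trans _ _ (\sum_(r : {ffun X -> N}) (a / 2 * n))).
      rewrite [leRHS](bigID (mem P)) /= lerDr sumr_ge0 // => r _.
      by rewrite mulr_ge0 ?divr_ge0 ?ltW.
    by rewrite sumr_const card_ffun -[_ *+ (_ ^ _)]mulr_natl natrX.
  by move: le; rewrite FX exprSr; lra.
have := card_glue P_ext; rewrite -(ler_nat R) !natr_sum; apply: le_trans.
apply: (@le_trans _ _ (\sum_(r in P) e * n ^+ #|F2|)); last first.
  by apply: ler_sum => r rP; apply: F2_ge; rewrite inE in rP.
rewrite sumr_const -mulr_natl card_sum exprD.
set x := n ^+ _ in P_ge *; set y := n ^+ _.
have y_ge0 : 0 <= y by rewrite exprn_ge0 // ltW.
have ey : 0 <= e * y by rewrite mulr_ge0.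
by have := ler_wpM2r ey P_ge; lra.
Qed.

End Count.
End Substitutions.

(** * Substitutions in sub-objects *)

Section SubObjects.
Variables (L : language) (R : realType).
Implicit Types (M N K : fstruct L) (phi psi : fstruct L -> R).
Local Open Scope classical_set_scope.

(* Otherwise subsets [B n] with a vanishing density of [M] would converge, along
   a subsequence, to a sub-object of [phi] in which [M] has density 0. *)
Lemma Pset_uniform phi S M (c : R) : converges_to S phi -> Pset phi M -> 0 < c ->
  exists2 e : R, 0 < e & \forall n \near \oo, forall B : {set S n},
    c * #|S n|%:R <= #|B|%:R ->
    e * #|S n|%:R ^+ #|M| <= #|embs_into M B|%:R.
Proof.
move=> S_phi M_phi c_gt0; apply: contrapT => noe.
have /choice[f fP] : forall k : nat, exists p : {n : nat & {set S n}},
    [/\ (k <= tag p)%N, (k <= #|tagged p|)%N,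
        c * #|S (tag p)|%:R <= #|tagged p|%:R &
        #|embs_into M (tagged p)|%:R < k.+1%:R^-1 * #|S (tag p)|%:R ^+ #|M| :> R].
  move=> k; apply: contrapT => nop; apply: noe.
  exists k.+1%:R^-1; first by rewrite invr_gt0.
  (* From this index on [c * #|S n|] is at least [k], so the counterexample [B] has at least [k]
     vertices. *)
  pose n0 := maxn k (Num.bound (k%:R / c)).
  exists n0 => // n /= n0n B cB; rewrite leNgt; apply/negP => lt.
  apply: nop; exists (existT (fun n => {set S n}) n B); split => //=.
    exact: leq_trans (leq_maxl _ _) n0n.
  rewrite -(ler_nat R); apply: le_trans cB; rewrite -ler_pdivrMl // mulrC.
  apply: ltW; apply: (@lt_le_trans _ _ (Num.bound (k%:R / c))%:R).
    by apply: archi_boundP; rewrite divr_ge0 // ltW.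
  rewrite ler_nat; apply: leq_trans (converges_to_ge S_phi n).
  exact: leq_trans (leq_maxr _ _) n0n.
pose num k := tag (f k); pose B k : {set S (num k)} := tagged (f k).
have num_ge k : (k <= num k)%N by have [] := fP k.
(* Along [g] the indices [num] increase strictly, so the host structures form a subsequence of [S]
   and still converge to [phi]. *)
have [g g_incr numg_incr] := increasing_subsequence num_ge.
pose T k := induced_on (B (g k)).
pose x k : R := #|B (g k)|%:R / #|S (num (g k))|%:R.
have T_ge k : (k <= #|T k|)%N.
  rewrite card_induced; apply: leq_trans (homo_ltn_ge g_incr k) _.
  by have [] := fP (g k).
have x01 k : 0 <= x k <= 1.
  rewrite divr_ge0 //=; have [S0|S0] := posnP #|S (num (g k))|.
    by rewrite /x S0 invr0 mulr0.
  by rewrite ler_pdivrMr ?ltr0n // mul1r ler_nat max_card.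
have [h [h_incr [psi [d [T_psi x_d]]]]] := convergent_subsequence T_ge x01.
have S_gt0 n : (0 < n)%N -> 0 < #|S n|%:R :> R.
  by move=> n0; rewrite ltr0n; exact: leq_trans (converges_to_ge S_phi n).
have gh_incr := homo_ltn_comp g_incr h_incr.
have num_gt0 n : (0 < n)%N -> (0 < num (g (h n)))%N.
  move=> n0; apply: leq_trans (num_ge _).
  exact: leq_trans n0 (homo_ltn_ge gh_incr n).
have d_ge : c <= d.
  apply: (cvgr_to_ge x_d); near=> n.
  rewrite /x ler_pdivlMr; first by have [] := fP (g (h n)).
  by apply/S_gt0/num_gt0; near: n; exists 1%N.
have psi_sub : sub_object psi phi.
  exists (S \o (num \o g \o h)), (fun n => B (g (h n))), d; split => //.
    have numgh_incr := homo_ltn_comp numg_incr h_incr.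
    split; first by move=> m n mn; exact/S_phi.1/numgh_incr.
    by move=> K; apply: (cvg_subsequence numgh_incr (S_phi.2 K)).
  exact: lt_le_trans d_ge.
have := M_phi _ psi_sub; rewrite /Qset /= => /(limit_gt0P M T_psi)[e e_gt0 e_le].
have : \forall n \near \oo, n.+1%:R^-1 < e * c ^+ #|M|.
  have ec_gt0 : 0 < e * c ^+ #|M| by rewrite mulr_gt0 ?exprn_gt0.
  exact: (near_infty_natSinv_lt (PosNum ec_gt0)).
(* At a large index [B] has at least [e * c ^+ #|M| * m ^+ #|M|] embeddings of [M], by positivity of
   [psi M], but it was chosen with fewer. *)
move=> lt_ec; have : \forall n \near \oo, False.
  near=> n.
  have n_gt0 : (0 < n)%N by near: n; exists 1%N.
  have [_ _ cB ltB] := fP (g (h n)); rewrite -/(num _) -/(B _) in cB ltB.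
  set m : R := #|S (num (g (h n)))|%:R in cB ltB.
  have m_gt0 : 0 < m by exact/S_gt0/num_gt0.
  have T_gt0 : 0 < #|T (h n)|%:R :> R.
    by rewrite card_induced; apply: lt_le_trans cB; rewrite mulr_gt0.
  have : e <= emb_density R M (T (h n)) by near: n.
  rewrite /emb_density ler_pdivlMr ?exprn_gt0 // card_embs_induced card_induced leNgt.
  move=> /negP; apply; apply: lt_le_trans ltB _.
  apply: (@le_trans _ _ (e * c ^+ #|M| * m ^+ #|M|)).
    rewrite ler_pM2r ?exprn_gt0 //.
    have lt_n : n.+1%:R^-1 < e * c ^+ #|M| by near: n.
    apply: le_trans (ltW lt_n); rewrite lef_pV2 ?posrE // ler_nat ltnS.
    exact: homo_ltn_ge gh_incr n.
  by rewrite -mulrA -exprMn ler_pM2l // lerXn2r ?nnegrE // mulr_ge0 // ltW.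
by case=> N _ /(_ N); apply => /=.
Unshelve. all: by end_near. Qed.

(** Many maps of [F1 - v] to [A n] have an extension set which is a positive fraction of [S n], and
    [Pset_uniform] finds many copies of [F2] in each. Finitely many codes share the resulting
    substitutions, so one of them has positive density. *)
Lemma sub_object_substitution phi psi (F1 F2 : fstruct L) (v : F1) : sub_object psi phi ->
  0 < psi F1 -> Pset phi F2 ->
  exists2 K, substitution v F2 K & 0 < psi K.
Proof.
move=> [S [A [c [S_phi c_gt0 A_c T_psi]]]] F1_psi F2_phi.
pose T n := induced_on (A n); rewrite -/T in T_psi.
have [e1 e1_gt0 e1_le] := (limit_gt0P F1 T_psi).1 F1_psi.
(* Eventually [A n] has at least [c / 2 * #|S n|] vertices, so [a] bounds the density of [F1] when
   normalised by [S n]. *)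
pose a := e1 * (c / 2) ^+ #|F1|.
have c2_gt0 : 0 < c / 2 by rewrite divr_gt0.
have a_gt0 : 0 < a by rewrite mulr_gt0 ?exprn_gt0.
have a2_gt0 : 0 < a / 2 by rewrite divr_gt0.
have [e e_gt0 e_le] := Pset_uniform S_phi F2_phi a2_gt0.
pose good := @substitution_code L F1 F2 v.
have lim : \sum_(k | good k) emb_density R (of_code k) (T n) @[n --> \oo] -->
    \sum_(k | good k) emb_limit psi (of_code k).
  by apply: cvg_sum_seq => k _; exact: emb_density_cvg.
have lim_ge : a / 2 * e <= \sum_(k | good k) emb_limit psi (of_code k).
  apply: (cvgr_to_ge lim); near=> n.
  have n_gt0 : (0 < n)%N by near: n; exists 1%N.
  have S_gt0 : 0 < #|S n|%:R :> R.
    by rewrite ltr0n; exact: leq_trans (converges_to_ge S_phi n).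
  have T_gt0 : 0 < #|T n|%:R :> R.
    by rewrite ltr0n; exact: leq_trans (converges_to_ge T_psi n).
  have F1_ge : a * #|S n|%:R ^+ #|F1| <= #|embs_into F1 (A n)|%:R.
    have : e1 <= emb_density R F1 (T n) by near: n.
    rewrite /emb_density ler_pdivlMr ?exprn_gt0 // card_embs_induced; apply: le_trans.
    rewrite /a -mulrA -exprMn ler_pM2l // lerXn2r ?nnegrE //.
      by rewrite mulr_ge0 // ltW.
    rewrite card_induced -ler_pdivlMr //.
    near: n; apply: (cvgr_ge _ A_c).
    by rewrite ltr_pdivrMr // ltr_pMr // ltr1n.
  have F2_ge : forall B : {set S n}, a / 2 * #|S n|%:R <= #|B|%:R ->
      e * #|S n|%:R ^+ #|F2| <= #|embs_into F2 B|%:R by near: n.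
  have := card_substitutions (N := S n) v _ a_gt0 F1_ge (ltW e_gt0) F2_ge.
  rewrite -(ltr0n R) => /(_ S_gt0).
  rewrite -ler_pdivlMr ?exprn_gt0 // mulr_suml => /le_trans; apply.
  apply: ler_sum => k _; rewrite /emb_density card_embs_induced.
  rewrite ler_wpM2l // [#|of_code k|]card_ord lef_pV2 ?posrE ?exprn_gt0 //.
  by rewrite lerXn2r ?nnegrE // ler_nat card_induced max_card.
apply: contrapT => noK.
have : \sum_(k | good k) emb_limit psi (of_code k) <= 0.
  apply: sumr_le0 => k /andP[_ /asboolP k_sub]; rewrite leNgt emb_limit_gt0.
  by apply/negP => k_gt0; apply: noK; exists (of_code k).
rewrite leNgt => /negP; apply; apply: lt_le_trans lim_ge.
by rewrite mulr_gt0.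
Unshelve. all: by end_near. Qed.

Lemma Pset_closed_under_substructures phi :
  closed_under_substructures (Pset phi).
Proof.
move=> M N MN N_phi psi psi_sub.
exact: limit_substructure (sub_object_limit psi_sub) MN (N_phi psi psi_sub).
Qed.

Lemma strongly_persistent_closed (F : set (fstruct L)) : strongly_persistent R F ->
  weakly_closed_under_substitutions F /\ closed_under_substructures F.
Proof.
move=> [phi phi_lim [phi_wr ->]]; split; last exact: Pset_closed_under_substructures.
move=> F1 F2 F1_phi F2_phi v; rewrite phi_wr in F1_phi *.
have [K K_sub K_phi] := sub_object_substitution v (sub_object_refl phi_lim) F1_phi F2_phi.
by exists K.
Qed.

Lemma size_le2P (T : Type) (s : seq T) : (size s <= 2)%N ->
  s = [::] \/ (exists x, s = [:: x]) \/ (exists x y, s = [:: x; y]).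
Proof.
case: s => [|x [|y [|//]]] _; [by left | by right; left; exists x |].
by right; right; exists x, y.
Qed.

(* In arity at most 2 a tuple either lies in the copy of [F2] or meets it at most
   once, and in the latter case lies in a copy of [F1]. *)
Lemma substitution_binary (F1 F2 K K' : fstruct L) (v : F1) : (forall P : L, (arity P <= 2)%N) ->
  (0 < #|F2|)%N ->
  substitution v F2 K -> substitution v F2 K' -> substructure K K'.
Proof.
move=> arity2 /card_gt0P[u0 _] [f1 [f2 [rK f2_emb ext_emb]]] [g1 [g2 [rK' g2_emb ext'_emb]]].
have K_cover y : (exists x, f1 x = y) \/ (exists u, f2 u = y).
  have : (range f1 `|` range f2) y by rewrite rK.
  by case=> [[x _ <-]|[u _ <-]]; [left; exists x | right; exists u].
have /choice[j jP] : forall y, exists y', (exists x, f1 x = y /\ g1 x = y') \/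
    (exists u, f2 u = y /\ g2 u = y').
  by move=> y; have [[x <-]|[u <-]] := K_cover y;
    [exists (g1 x); left; exists x | exists (g2 u); right; exists u].
have [f1_inj f12] := substitution_disjoint u0 ext_emb.
have j1 x : j (f1 x) = g1 x.
  have [[x' [/f1_inj -> <-] //]|[u [/esym /f12]]] := jP (f1 x); done.
have j2 u : j (f2 u) = g2 u.
  have [[x [/f12 //]]|[u' [/f2_emb.1 -> <-]]] := jP (f2 u); done.
have j_ext u x : j (extend f1 (f2 u) x) = extend g1 (g2 u) x.
  by have [[-> _]|[y -> _]] := extend_spec f1 (f2 u) x;
    rewrite ?extend_at ?extend_off ?j1 ?j2.
(* Any two vertices of [K] lie in a common copy of [F1] or in the copy of [F2], and [j] is
   compatible with both kinds of copies. *)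
pose via1 (y y' : K) := exists u x x', y = extend f1 (f2 u) x /\ y' = extend f1 (f2 u) x'.
pose via2 (y y' : K) := exists u u', y = f2 u /\ y' = f2 u'.
have via y y' : via1 y y' \/ via2 y y'.
  have [[x <-]|[u <-]] := K_cover y; have [[x' <-]|[u' <-]] := K_cover y'.
  - by left; exists u0, (val x), (val x'); rewrite !extend_off.
  - by left; exists u', (val x), v; rewrite extend_off extend_at.
  - by left; exists u, v, (val x'); rewrite extend_off extend_at.
  - by right; exists u, u'.
exists j; split.
  move=> y y'; have [[u [x [x' [-> ->]]]]|[u [u' [-> ->]]]] := via y y'.
    by rewrite !j_ext => /(ext'_emb u).1 ->.
  by rewrite !j2 => /g2_emb.1 ->.
move=> P t.
suff [[u [t1 tE]]|[t2 tE]] : (exists u (t1 : (arity P).-tuple F1),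
      t = map_tuple (extend f1 (f2 u)) t1) \/
    (exists t2 : (arity P).-tuple F2, t = map_tuple f2 t2).
- rewrite tE (ext_emb u).2 -(ext'_emb u).2 -holds_comp; congr (holds K' P _).
  by apply: val_inj => /=; apply: eq_map => x; rewrite /= j_ext.
- rewrite tE f2_emb.2 -g2_emb.2 -holds_comp; congr (holds K' P _).
  by apply: val_inj => /=; apply: eq_map => x; rewrite /= j2.
have tuple_of (T : Type) (f : T -> K) (s : seq T) : val t = map f s ->
    exists t1 : (arity P).-tuple T, t = map_tuple f t1.
  move=> ts; have s_size : size s == arity P.
    by rewrite -(size_map f) -ts size_tuple.
  by exists (Tuple s_size); apply: val_inj.
have : (size (val t) <= 2)%N by rewrite size_tuple.
move=> /size_le2P[t0|[[y ty]|[y [y' ty]]]].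
- by left; exists u0; apply: (tuple_of _ _ [::]).
- have [[u [x [_ [yE _]]]]|[u [_ [yE _]]]] := via y y.
    by left; exists u; apply: (tuple_of _ _ [:: x]); rewrite ty yE.
  by right; apply: (tuple_of _ _ [:: u]); rewrite ty yE.
- have [[u [x [x' [yE yE']]]]|[u [u' [yE yE']]]] := via y y'.
    by left; exists u; apply: (tuple_of _ _ [:: x; x']); rewrite ty yE yE'.
  by right; apply: (tuple_of _ _ [:: u; u']); rewrite ty yE yE'.
Qed.

(** Each sub-object has a substitution of positive density, a priori its own. By
    [substitution_binary] the one found for [phi] embeds in all of them, so it has positive density
    throughout. *)
Lemma persistent_closed (F : set (fstruct L)) : (forall P : L, (arity P <= 2)%N) ->
  persistent R F ->
  weakly_closed_under_substitutions F /\ closed_under_substructures F.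
Proof.
move=> arity2 [phi phi_lim ->]; split; last exact: Pset_closed_under_substructures.
move=> F1 F2 F1_phi F2_phi v.
have sub psi (psi_phi : sub_object psi phi) :
    exists2 K, substitution v F2 K & 0 < psi K.
  exact: sub_object_substitution psi_phi (F1_phi psi psi_phi) F2_phi.
(* For empty [F2] a substitution only asks that [f1] be onto, so uniqueness fails; [F1] without [v]
   is then chosen. *)
have [F2_0|F2_gt0] := posnP #|F2|; last first.
  have [K K_sub _] := sub phi (sub_object_refl phi_lim); exists K => // psi psi_phi.
  have [K' K'_sub K'_psi] := sub psi psi_phi.
  apply: limit_substructure (sub_object_limit psi_phi) _ K'_psi.
  exact: substitution_binary K_sub K'_sub.
have no_F2 (u : F2) : False by have := card0_eq F2_0 u.
pose K := induced_on (finset (fun x : F1 => x != v)).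
have F1v (x : {x : F1 | x != v}) : val x \in finset (fun x : F1 => x != v).
  by rewrite inE; exact: (valP x).
exists K; last first.
  apply: Pset_closed_under_substructures F1_phi.
  by exists (@enum_val F1 _); exact: enum_val_embedding.
have [f2 f2_emb] := empty_substructure K F2_0.
exists (fun x => enum_rank_in (F1v x) (val x)), f2; split=> //.
apply/seteqP; split => // y _; left.
have yv : enum_val y != v by have := enum_valP y; rewrite inE.
by exists (exist (fun x : F1 => x != v) _ yv) => //=; rewrite enum_valK_in.
Qed.

End SubObjects.

(** * Blow-ups and free sets *)

Section BlowUps.
Variable L : language.
Implicit Types M N K G : fstruct L.

(** The fibres of [p] are cells of equal size, and one vertex from each cell gives a copy of [N].
    Tuples with two entries in one cell are left free. *)
Definition blowup_map N K (p : K -> N) (q : nat) : Prop :=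
  [/\ (0 < q)%N,
      forall x, #|finset (fun y : K => p y == x)| = q &
      forall s : N -> K, cancel s p -> embedding s].

Lemma card_fibres N K (p : K -> N) (q : nat) (V : {set N}) :
  (forall x, #|finset (fun y : K => p y == x)| = q) ->
  #|p @^-1: V| = (#|V| * q)%N.
Proof.
move=> p_card; rewrite -sum1_card (partition_big p (mem V)) /=; last first.
  by move=> y; rewrite inE.
rewrite (eq_bigr (fun=> q)) ?sum_nat_const // => x xV.
rewrite sum1dep_card -(p_card x); apply: eq_card => y; rewrite !inE.
by apply/andP/idP => [[]//|/eqP yx]; rewrite yx xV eqxx.
Qed.

Lemma card_blowup N K (p : K -> N) (q : nat) :
  blowup_map p q -> #|K| = (#|N| * q)%N.
Proof.
move=> [_ p_card _]; rewrite -(cardsT N) -(card_fibres _ p_card) -cardsT.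
by apply: eq_card => y; rewrite !inE.
Qed.

Lemma section_extension N K (p : K -> N) (q : nat) (V : {set N}) (s : N -> K) :
  blowup_map p q -> (forall x, x \in V -> p (s x) = x) ->
  exists2 s' : N -> K, embedding s' & forall x, x \in V -> s' x = s x.
Proof.
move=> [q_gt0 p_card p_sec] sV.
have /choice[s' s'P] : forall x, exists y, p y = x /\ (x \in V -> y = s x).
  move=> x; case: (boolP (x \in V)) => xV; first by exists (s x); rewrite sV.
  have /card_gt0P[y] : (0 < #|finset (fun y : K => p y == x)|)%N by rewrite p_card.
  by rewrite inE => /eqP yx; exists y.
exists s'; first by apply: p_sec => x; have [] := s'P x.
by move=> x; have [] := s'P x.
Qed.

(** For a section [s] of [p \o r], the map [r \o s] is a section of [p], and [s \o p] is a section
    of [r] over its image; [s] is the composite of the two. *)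
Lemma blowup_comp N K G (p : K -> N) (r : G -> K) (q q' : nat) :
  blowup_map p q -> blowup_map r q' -> blowup_map (p \o r) (q * q').
Proof.
move=> p_bl r_bl; have [q_gt0 p_card p_sec] := p_bl; have [q'_gt0 r_card _] := r_bl.
split; first by rewrite muln_gt0 q_gt0.
  move=> x; rewrite -(p_card x) -(card_fibres _ r_card).
  by apply: eq_card => y; rewrite !inE.
move=> s sK; have rs_emb : embedding (r \o s) by exact: p_sec.
have [|s' s'_emb s'E] := @section_extension _ _ _ _ ((r \o s) @: [set: N]) (s \o p) r_bl.
  by move=> _ /imsetP[x _ ->] /=; rewrite [p _](sK x).
apply: embedding_eq (embedding_comp rs_emb s'_emb) => x.
by rewrite [LHS]s'E /= ?[p _](sK x) //; apply: (imset_f (r \o s)); rewrite inE.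
Qed.

Lemma blowup_id N : blowup_map (@id N) 1.
Proof.
split=> // [x|s sK].
  by rewrite -(cards1 x); apply: eq_card => y; rewrite !inE.
by apply: embedding_eq (embedding_id N) => x; rewrite sK.
Qed.

Definition free M N (U : {set N}) : Prop :=
  ~ exists w : M -> N, embedding w /\ forall x, w x \in U.

(** A copy of [M] among the cells that meet [U] lifts to [U] along a section which picks vertices of
    [U] where it can. *)
Lemma free_image M N K (p : K -> N) (q : nat) (U : {set K}) :
  blowup_map p q -> free M U -> free M (p @: U).
Proof.
move=> p_bl U_free [w [w_emb wU]]; apply: U_free.
have pre x : x \in p @: U -> exists y, y \in U /\ p y = x.
  by move=> /imsetP[y yU ->]; exists y.
(* The choice below needs a default vertex [y0]; there is one unless [M] is empty. *)
have [M0|[y0 _]] : (#|M| = 0)%N \/ exists y0 : K, y0 \in U.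
- have [->|/card_gt0P[x _]] := posnP #|M|; first by left.
  by have [y [yU _]] := pre _ (wU x); right; exists y.
- have [f f_emb] := empty_substructure K M0.
  by exists f; split=> // x; have := card0_eq M0 x.
have /choice[s sP] : forall x, exists y, x \in p @: U -> y \in U /\ p y = x.
  move=> x; case: (boolP (x \in p @: U)) => [/pre[y yP]|_]; first by exists y.
  by exists y0.
have [x /sP[] //|s' s'_emb s'E] := @section_extension _ _ _ _ (p @: U) s p_bl.
exists (s' \o w); split; first exact: embedding_comp.
by move=> x; rewrite /= s'E //; have [] := sP _ (wU x).
Qed.

Section FreeBound.
Variable R : realType.

Definition free_bound M N (e : R) : Prop :=
  forall U : {set N}, free M U -> #|U|%:R <= e * #|N|%:R.

(** A free set meets at most [e * #|N|] cells, by [free_image], and has at most [k] of the [q]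
    vertices in each. *)
Lemma free_bound_fibres M N K (p : K -> N) (q k : nat) (e : R) :
  blowup_map p q ->
  (forall (U : {set K}) x, free M U ->
     (#|finset (fun y : K => (y \in U) && (p y == x))| <= k)%N) ->
  free_bound M N e -> free_bound M K (e * (k%:R / q%:R)).
Proof.
move=> p_bl U_k N_e U U_free; have [q_gt0 _ _] := p_bl.
have q0 : 0 < q%:R :> R by rewrite ltr0n.
have le : (#|U| <= #|p @: U| * k)%N.
  rewrite -sum1_card (partition_big p (mem (p @: U))) /=; last by move=> y; exact: imset_f.
  rewrite -sum_nat_const; apply: leq_sum => x _.
  rewrite sum1dep_card; apply: leq_trans (U_k U x U_free).
  by apply: subset_leq_card; apply/fintype.subsetP => y; rewrite !inE.
move: le; rewrite -(ler_nat R) natrM => /le_trans; apply.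
have /N_e le := free_image p_bl U_free.
rewrite (card_blowup p_bl) natrM.
rewrite (_ : _ * (_ * _) = e * #|N|%:R * k%:R); first by rewrite ler_wpM2r.
have := @divff _ (q%:R : R) (negbT (gt_eqF q0)); set q' := q%:R^-1 => qV.
by transitivity (e * #|N|%:R * k%:R * (q%:R * q')); [lra | rewrite qV mulr1].
Qed.

Lemma free_bound_blowup M N K (p : K -> N) (q : nat) (e : R) :
  blowup_map p q -> free_bound M N e -> free_bound M K e.
Proof.
move=> p_bl N_e; have [q_gt0 p_card _] := p_bl.
rewrite -[e]mulr1 -(@divff _ (q%:R : R)) ?pnatr_eq0 -?lt0n //.
apply: free_bound_fibres p_bl _ N_e => U x _.
rewrite -(p_card x); apply: subset_leq_card; apply/fintype.subsetP => y.
by rewrite !inE => /andP[].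
Qed.

End FreeBound.

(** The vertices in [r] are replaced by [G] one at a time. The cells still to be replaced are single
    vertices, and the next substitution takes place at such a vertex. *)
Lemma partial_blowup (F : set (fstruct L)) N G (r : seq N) :
  weakly_closed_under_substitutions F -> F N -> F G -> (0 < #|G|)%N -> uniq r ->
  exists2 K, F K & exists p : K -> N,
    [/\ forall s, cancel s p -> embedding s,
        forall x, x \in r -> exists2 g : G -> K, embedding g &
          forall y, p y = x <-> exists u, g u = y &
        forall x, x \notin r -> exists y0, forall y, p y = x <-> y = y0].
Proof.
move=> F_sub FN FG /card_gt0P[u0 _]; elim: r => [_|v r IHr /= /andP[vr r_uniq]].
  exists N => //; exists id; split=> // [s sK|x _]; last by exists x.
  by apply: embedding_eq (embedding_id N) => x; rewrite sK.
have [K FK [p [p_sec p_in p_out]]] := IHr r_uniq.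
have [v' v'P] := p_out v vr.
have pv' : p v' = v by exact/v'P.
have [K' [f1 [f2 [cover f2_emb ext_emb]]] FK'] := F_sub K G FK FG v'.
have [f1_inj f12] := substitution_disjoint u0 ext_emb.
have K'_cover z : (exists y, f1 y = z) \/ (exists u, f2 u = z).
  have : (range f1 `|` range f2)%classic z by rewrite cover.
  by case=> [[y _ <-]|[u _ <-]]; [left; exists y | right; exists u].
have /choice[p' p'P] : forall z, exists x,
    (exists y, f1 y = z /\ x = p (val y)) \/ (exists u, f2 u = z /\ x = v).
  by move=> z; have [[y <-]|[u <-]] := K'_cover z;
    [exists (p (val y)); left; exists y | exists v; right; exists u].
have p'1 y : p' (f1 y) = p (val y).
  by have [[y' [/f1_inj -> -> //]]|[u [/esym /f12]]] := p'P (f1 y).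
have p'2 u : p' (f2 u) = v.
  by have [[y [/f12 //]]|[u' [_ ->]]] := p'P (f2 u).
have pv (y : {x : K | x != v'}) : p (val y) <> v by move=> /v'P yv; have := valP y; rewrite yv eqxx.
pose ext u := extend f1 (f2 u).
have p'ext u y : p' (ext u y) = p y.
  by have [[-> e]|[y' -> e]] := extend_spec f1 (f2 u) y; rewrite /ext e ?p'1 ?p'2.
(* The copy [ext u] of [K] contains all of [K'] except the vertices of the new cell other than
   [f2 u]. *)
have lift u z : p' z <> v \/ z = f2 u -> exists y, ext u y = z.
  have [[y <-] _|[u' <-]] := K'_cover z.
    by exists (val y); rewrite /ext extend_off.
  by case=> [|->]; [rewrite p'2 | exists v'; rewrite /ext extend_at].
exists K' => //; exists p'; split.
(* A section meets the new cell in a single [f2 u], so it factors through [ext u]. *)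
- move=> s sK.
  have [u sv] : exists u, s v = f2 u.
    have [[y ys]|[u us]] := K'_cover (s v); last by exists u.
    by have := pv y; rewrite -p'1 ys sK.
  have /choice[s' s'P] : forall x, exists y, ext u y = s x.
    move=> x; apply: lift; have [->|/eqP xv] := eqVneq x v; first by right.
    by left; rewrite sK.
  have s'K : cancel s' p by move=> x; rewrite -(p'ext u) s'P sK.
  exact: embedding_eq s'P (embedding_comp (p_sec s' s'K) (ext_emb u)).
- move=> x; rewrite inE; have [-> _|/eqP xv /= xr] := eqVneq x v.
    exists f2 => // z; split=> [zv|[u <-] //].
    by have [[y ys]|//] := K'_cover z; have := pv y; rewrite -p'1 ys.
  have [g g_emb gP] := p_in x xr.
  exists (ext u0 \o g); first exact: embedding_comp (ext_emb u0).
  move=> z; split=> [zx|[u <-]]; last by rewrite /= p'ext; apply/gP; exists u.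
  have [|y yz] := lift u0 z; first by left; rewrite zx.
  have /gP[u uy] : p y = x by rewrite -(p'ext u0) yz.
  by exists u; rewrite /= uy.
- move=> x; rewrite inE negb_or => /andP[/eqP xv xr].
  have [y0 y0P] := p_out x xr; exists (ext u0 y0) => z.
  split=> [zx|->]; last by rewrite p'ext; apply/y0P.
  have [|y yz] := lift u0 z; first by left; rewrite zx.
  have /y0P yy0 : p y = x by rewrite -(p'ext u0) yz.
  by rewrite -yz yy0.
Qed.

Lemma full_blowup (F : set (fstruct L)) N G :
  weakly_closed_under_substitutions F -> F N -> F G -> (0 < #|G|)%N ->
  exists2 K, F K & exists2 p : K -> N, blowup_map p #|G| &
    forall x, exists2 g : G -> K, embedding g & forall u, p (g u) = x.
Proof.
move=> F_sub FN FG G_gt0.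
have [K FK [p [p_sec p_in _]]] := partial_blowup F_sub FN FG G_gt0 (enum_uniq N).
have {}p_in x := p_in x (mem_enum N x).
exists K => //; exists p; last first.
  by move=> x; have [g g_emb gP] := p_in x; exists g => // u; apply/gP; exists u.
split=> // x; have [g [g_inj _] gP] := p_in x.
rewrite -(card_imset _ g_inj); apply: eq_card => y; rewrite inE.
apply/eqP/imsetP => [/gP[u <-]|[u _ ->]]; first by exists u.
by apply/gP; exists u.
Qed.

(** Each cell is a copy of [G], so a [G]-free set misses a vertex in each. *)
Lemma free_bound_full_blowup (R : realType) (F : set (fstruct L)) N G :
  weakly_closed_under_substitutions F -> F N -> F G -> (0 < #|G|)%N ->
  exists2 K, F K & (exists p : K -> N, blowup_map p #|G|) /\
    forall e : R, free_bound G N e ->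
      free_bound G K (e * (#|G|.-1%:R / #|G|%:R)).
Proof.
move=> F_sub FN FG G_gt0; have [K FK [p p_bl p_copy]] := full_blowup F_sub FN FG G_gt0.
exists K => //; split; first by exists p.
have [_ p_card _] := p_bl.
move=> e; apply: (free_bound_fibres p_bl) => U x U_free.
rewrite -ltnS (prednK G_gt0) -(p_card x); apply: proper_card; apply/properP; split.
  by apply/fintype.subsetP => y; rewrite !inE => /andP[].
have [g g_emb gx] := p_copy x.
have [u gu] : exists u, g u \notin U.
  apply: contrapT => noU; apply: U_free; exists g; split=> // u.
  by apply: contrapT => /negP gu; apply: noU; exists u.
exists (g u); first by rewrite inE gx.
by rewrite inE (negbTE gu).
Qed.

End BlowUps.

(** * Free sets in random samples *)

Lemma sumr_card (R : pzSemiRingType) (I : finType) (A : pred I) (c : R) :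
  \sum_(i in A) c = #|A|%:R * c.
Proof. by rewrite sumr_const mulr_natl. Qed.

Section Moments.
Variables (R : realFieldType) (T : finType) (s : nat).
Implicit Types f : T -> R.

Lemma sum_ffun_prod (g : 'I_s -> T -> R) :
  \sum_(w : {ffun 'I_s -> T}) \prod_k g k (w k) = \prod_k \sum_x g k x.
Proof. by rewrite (bigA_distr_bigA g). Qed.

(** A sum over all maps is an expectation over [s] independent uniform vertices, up to the factor
    [#|T| ^+ s]; the factor [#|T|] on the left avoids a division. *)
Lemma sum_sample f (i : 'I_s) :
  #|T|%:R * (\sum_(w : {ffun 'I_s -> T}) f (w i)) =
  #|T|%:R ^+ s * \sum_x f x.
Proof.
pose g k x := if k == i then f x else 1.
have -> : \sum_(w : {ffun 'I_s -> T}) f (w i) =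
    \sum_(w : {ffun 'I_s -> T}) \prod_k g k (w k).
  apply: eq_bigr => w _; rewrite (bigD1 i) //= /g eqxx big1 ?mulr1 // => k.
  by move=> /negbTE ->.
rewrite sum_ffun_prod (bigD1 i) //=.
under eq_bigr do rewrite /g eqxx.
rewrite [X in _ * (_ * X)](eq_bigr (fun=> #|T|%:R)); last first.
  move=> k /negbTE ki; rewrite (eq_bigr (fun=> 1)) ?sumr_const //.
  by move=> x _; rewrite /g ki.
rewrite (prodr_const (predC1 i)) mulrCA mulrC -exprS; congr (_ ^+ _ * _).
by rewrite -[RHS]card_ord -(cardC (pred1 i)) card1.
Qed.

Lemma sum_sample_mixed f (i j : 'I_s) : i != j -> \sum_x f x = 0 ->
  \sum_(w : {ffun 'I_s -> T}) f (w i) * f (w j) = 0.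
Proof.
move=> ij f0.
pose g k x := if k == i then f x else if k == j then f x else 1.
have -> : \sum_(w : {ffun 'I_s -> T}) f (w i) * f (w j) =
    \sum_(w : {ffun 'I_s -> T}) \prod_k g k (w k).
  apply: eq_bigr => w _; rewrite (bigD1 i) // (bigD1 j) 1?eq_sym //= /g !eqxx.
  rewrite [j == i]eq_sym (negbTE ij) big1 ?mulr1 // => k.
  by move=> /andP[/negbTE -> /negbTE ->].
rewrite sum_ffun_prod (bigD1 i) //=.
by under eq_bigr do rewrite /g eqxx; rewrite f0 mul0r.
Qed.

(** The mixed terms of the square vanish by independence, as [f] has mean 0. *)
Lemma sum_sample_sqr f : \sum_x f x = 0 ->
  #|T|%:R * (\sum_(w : {ffun 'I_s -> T}) (\sum_i f (w i)) ^+ 2) =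
  s%:R * #|T|%:R ^+ s * \sum_x f x ^+ 2.
Proof.
move=> f0.
have -> : \sum_(w : {ffun 'I_s -> T}) (\sum_i f (w i)) ^+ 2 =
    \sum_(i < s) \sum_(w : {ffun 'I_s -> T}) f (w i) ^+ 2.
  rewrite [RHS]exchange_big /=.
  under eq_bigr do rewrite expr2 big_distrlr /=.
  under [RHS]eq_bigr do [].
  rewrite exchange_big [RHS]exchange_big /=; apply: eq_bigr => i _.
  rewrite exchange_big (bigD1 i) //= [X in _ + X]big1 ?addr0 // => j ji.
  by rewrite sum_sample_mixed // eq_sym.
have sqrE i : #|T|%:R * (\sum_(w : {ffun 'I_s -> T}) f (w i) ^+ 2) =
    #|T|%:R ^+ s * \sum_x f x ^+ 2 := sum_sample (fun x => f x ^+ 2) i.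
rewrite [LHS]mulr_sumr; under eq_bigr do rewrite sqrE.
by rewrite sumr_card card_ord mulrA.
Qed.

End Moments.

Section Sampling.
Variables (L : language) (R : realType).
Implicit Types M N K G : fstruct L.

Definition max_free M G : nat :=
  \max_(U : {set G} | `[< free M U >]) #|U|.

(** The alternative [set0] covers the case that no set is free, as for empty [M], where the maximum
    defaults to 0. *)
Lemma max_free_attained M G : exists2 U : {set G},
  free M U \/ U = finset.set0 & max_free M G = #|U|.
Proof.
apply: (big_ind (fun k => exists2 U : {set G}, free M U \/ U = finset.set0 & k = #|U|)).
- by exists finset.set0; [right | rewrite cards0].
- by move=> x y [U UP ->] [V VP ->]; rewrite /maxn; case: ifP => _; [exists V | exists U].
- by move=> U /asboolP U_free; exists U => //; left.
Qed.

Lemma free_pullback M K s (w : 'I_s -> K) (U : {set pullback w}) :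
  injective w -> free M U -> free M (w @: (U : {set 'I_s})).
Proof.
move=> w_inj U_free [e [e_emb eU]]; apply: U_free.
have /choice[j jP] : forall x, exists i : pullback w, i \in U /\ w i = e x.
  by move=> x; have /imsetP[i iU ->] := eU x; exists i.
exists j; split; last by move=> x; have [] := jP x.
apply: embedding_factor (pullback_embedding w_inj) _.
by apply: embedding_eq e_emb => x /=; have [] := jP x.
Qed.


Section Cells.
Variables (M N K : fstruct L) (p : K -> N) (q s : nat).
Hypothesis p_bl : blowup_map p q.
Hypothesis N_gt0 : (0 < #|N|)%N.

(** The indicator of a cell is centred: all cells have the same size, so its mean is [1 / #|N|]. *)
Definition deviation (x : N) (y : K) : R := (p y == x)%:R - #|N|%:R^-1.

Lemma N_neq0 : #|N|%:R != 0 :> R.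
Proof. by rewrite pnatr_eq0 -lt0n. Qed.

Lemma sum_fibre x : \sum_y (p y == x)%:R = q%:R :> R.
Proof.
have [_ p_card _] := p_bl.
rewrite -(p_card x) -sum1_card natr_sum [RHS]big_mkcond.
by apply: eq_bigr => y _; rewrite inE; case: (p y == x).
Qed.

Lemma sum_deviation x : \sum_y deviation x y = 0.
Proof.
rewrite sumrB sum_fibre sumr_card (card_blowup p_bl) natrM.
by rewrite mulrAC divff ?N_neq0 // mul1r subrr.
Qed.

Lemma sum_deviation_sqr x : \sum_y deviation x y ^+ 2 <= q%:R.
Proof.
set D : R := #|N|%:R^-1.
have D_ge0 : 0 <= D by rewrite invr_ge0.
(* For [b] equal to 0 or 1, the square of [b - D] is [(1 - D) * b - D * (b - D)], and the last term
   sums to 0. *)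
have -> : \sum_y deviation x y ^+ 2 =
    \sum_y ((1 - D) * (p y == x)%:R - D * deviation x y).
  by apply: eq_bigr => y _; rewrite /deviation -/D; case: (p y == x); rewrite ?mulr1n ?mulr0n; lra.
rewrite sumrB -!mulr_sumr sum_deviation sum_fibre mulr0 subr0 mulrBl mul1r.
by rewrite lerBlDr lerDl mulr_ge0.
Qed.

Definition discrepancy (w : {ffun 'I_s -> K}) : R :=
  \sum_x (\sum_i deviation x (w i)) ^+ 2.

(** The expected square is at most [s * q / #|K| = s / #|N|] for each of the [#|N|] cells. *)
Lemma sum_discrepancy :
  \sum_(w : {ffun 'I_s -> K}) discrepancy w <= s%:R * #|K|%:R ^+ s.
Proof.
have K_gt0 : 0 < #|K|%:R :> R.
  by rewrite ltr0n (card_blowup p_bl) muln_gt0 N_gt0; have [] := p_bl.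
rewrite -(ler_pM2l K_gt0) exchange_big /= mulr_sumr.
under eq_bigr => x _ do rewrite (sum_sample_sqr _ (sum_deviation x)).
rewrite -mulr_sumr mulrC ler_wpM2r ?mulr_ge0 ?exprn_ge0 //.
apply: (@le_trans _ _ (\sum_(x : N) q%:R)).
  by apply: ler_sum => x _; exact: sum_deviation_sqr.
by rewrite sumr_card (card_blowup p_bl) natrM.
Qed.

(* By [d <= d^2/(2t) + t/2] applied to the deviation of each cell that meets the
   sampled free set; these cells form a free set of [N]. *)
Lemma card_free_sample (e t : R) (w : {ffun 'I_s -> K}) (U : {set pullback w}) :
  0 < t -> free_bound M N e -> injective w -> free M U ->
  #|U|%:R <= e * s%:R + #|N|%:R * t / 2 + discrepancy w / (2 * t).
Proof.
move=> t_gt0 N_e w_inj U_free.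
pose V := p @: (w @: (U : {set 'I_s})).
have V_e : #|V|%:R <= e * #|N|%:R.
  by apply/N_e/(free_image p_bl)/free_pullback.
pose cell x : R := \sum_i (p (w i) == x)%:R.
have U_le : #|U|%:R <= \sum_(x in V) cell x.
  rewrite exchange_big /= -sum1_card natr_sum.
  rewrite [leRHS](bigID (mem (U : {set 'I_s}))) /=.
  apply: ler_wpDr; first by apply: sumr_ge0 => i _; apply: sumr_ge0.
  apply: ler_sum => i iU.
  have iV : p (w i) \in V by do 2 apply: imset_f.
  rewrite (bigD1 (p (w i))) //= eqxx lerDl; exact: sumr_ge0.
apply: le_trans U_le _.
have cellE x : cell x = \sum_i deviation x (w i) + s%:R / #|N|%:R.
  by rewrite sumrB sumr_card card_ord subrK.
have young (d : R) : d <= d ^+ 2 / (2 * t) + t / 2.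
  rewrite -subr_ge0.
  have -> : d ^+ 2 / (2 * t) + t / 2 - d = (d - t) ^+ 2 / (2 * t).
    have t2 : 2 * t != 0 by rewrite gt_eqF // mulr_gt0.
    by apply: (mulIf t2); rewrite mulrBl mulrDl !divfK //; lra.
  by rewrite divr_ge0 ?sqr_ge0 // mulr_ge0 // ltW.
apply: (@le_trans _ _ (\sum_(x in V)
    ((\sum_i deviation x (w i)) ^+ 2 / (2 * t) + t / 2 + s%:R / #|N|%:R))).
  by apply: ler_sum => x _; rewrite cellE lerD2r young.
have N0 : 0 < #|N|%:R :> R by rewrite ltr0n.
have V_le : #|V|%:R * (s%:R / #|N|%:R) <= e * s%:R.
  by rewrite mulrA ler_pdivrMr // mulrAC ler_wpM2r.
have t_le : #|V|%:R * (t / 2) <= #|N|%:R * (t / 2).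
  by apply: ler_wpM2r; [rewrite divr_ge0 // ltW | rewrite ler_nat max_card].
have d_le : \sum_(x in V) (\sum_i deviation x (w i)) ^+ 2 / (2 * t) <=
    discrepancy w / (2 * t).
  rewrite -mulr_suml; apply: ler_wpM2r; first by rewrite invr_ge0 mulr_ge0 // ltW.
  rewrite /discrepancy [leRHS](bigID (mem V)) /= lerDl sumr_ge0 // => x _.
  exact: sqr_ge0.
rewrite !big_split /= !sumr_card; lra.
Qed.

Lemma sum_max_free_blowup (e : R) : 0 < e -> (0 < s)%N ->
  #|N|%:R <= 4 * e ^+ 2 * s%:R -> free_bound M N e ->
  \sum_(w : {ffun 'I_s -> K} | injectiveb w) (max_free M (pullback w))%:R <=
    3 * e * s%:R * #|K|%:R ^+ s.
Proof.
move=> e_gt0 s_gt0 N_le N_e.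
have N0 : 0 < #|N|%:R :> R by rewrite ltr0n.
have s0 : 0 < s%:R :> R by rewrite ltr0n.
(* This [t] makes the second term of [card_free_sample] equal to [e * s]; the third averages to at
   most [#|N| / (4 * e)], again at most [e * s] by hypothesis. *)
pose t : R := 2 * e * s%:R / #|N|%:R.
have t_gt0 : 0 < t by rewrite divr_gt0 // !mulr_gt0.
have tN : #|N|%:R * t / 2 = e * s%:R.
  by rewrite /t mulrCA mulfV ?N_neq0 // mulr1; lra.
pose b : R := e * s%:R + e * s%:R.
have b_ge0 : 0 <= b by rewrite addr_ge0 // mulr_ge0 // ltW.
have disc_ge0 w : 0 <= discrepancy w / (2 * t).
  apply: divr_ge0; last by rewrite mulr_ge0 // ltW.
  by apply: sumr_ge0 => x _; exact: sqr_ge0.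
apply: (@le_trans _ _ (\sum_(w : {ffun 'I_s -> K}) (b + discrepancy w / (2 * t)))).
  rewrite [leRHS](bigID (fun w : {ffun 'I_s -> K} => injectiveb w)) /=.
  apply: ler_wpDr; first by apply: sumr_ge0 => w _; rewrite addr_ge0.
  apply: ler_sum => w /injectiveP w_inj; rewrite /max_free.
  have := max_free_attained M (pullback w); rewrite /max_free.
  move=> [U [U_free|->] ->]; last by rewrite cards0 addr_ge0.
  by apply: le_trans (card_free_sample t_gt0 N_e w_inj U_free) _; rewrite tN.
rewrite big_split /= sumr_card card_ffun [#|'I_s|]card_ord -mulr_suml.
have := sum_discrepancy; rewrite natrX.
set n : R := #|K|%:R ^+ s; set Q : R := \sum_w _ => Q_le.
have n_ge0 : 0 <= n by rewrite exprn_ge0.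
have : Q / (2 * t) <= e * s%:R * n.
  have t2_gt0 : 0 < 2 * t by lra.
  rewrite ler_pdivrMr //; apply: (le_trans Q_le).
  rewrite mulrAC ler_wpM2r // -[leLHS]mul1r.
  have -> : e * s%:R * (2 * t) = (4 * e ^+ 2 * s%:R / #|N|%:R) * s%:R.
    by rewrite /t; lra.
  by rewrite ler_wpM2r // ler_pdivlMr // mul1r.
by rewrite /b; lra.
Qed.

End Cells.

(** On average [s * #|A| / #|K|] sample points fall in [A]. If the sample is injective and has no
    copy of [M] inside [A], they form a free set; otherwise their number is bounded by [s]. *)
Lemma sample_lower M K (A : {set K}) s : (#|M| <= s)%N ->
  s%:R * #|A|%:R * #|K|%:R ^+ s <= #|K|%:R *
    (\sum_(w : {ffun 'I_s -> K} | injectiveb w) (max_free M (pullback w))%:R +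
     s%:R * (#|K| ^ s - #|K| ^_ s)%:R +
     s%:R * (s%:R ^+ #|M| * #|embs_into M A|%:R * #|K|%:R ^+ (s - #|M|))) :> R.
Proof.
move=> Ms.
pose cnt (w : {ffun 'I_s -> K}) : nat := #|finset (fun i => w i \in A)|.
have cnt_le w : (cnt w <= s)%N by rewrite -[s in leqRHS]card_ord max_card.
pose hit (w : {ffun 'I_s -> K}) : bool :=
  [exists j : {ffun M -> 'I_s}, injectiveb j && ([ffun x => w (j x)] \in embs_into M A)].
(* Union bound over the at most [s ^ #|M|] positions of the copy within the sample. *)
have hit_card : (#|finset hit| <= s ^ #|M| * (#|embs_into M A| * #|K| ^ (s - #|M|)))%N.
  apply: (@leq_trans (\sum_(j : {ffun M -> 'I_s} | injectiveb j)
      #|finset (fun w : {ffun 'I_s -> K} => [ffun x => w (j x)] \in embs_into M A)|)).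
    rewrite -sum1_card big_mkcond /=.
    under [leqRHS]eq_bigr do rewrite -sum1_card big_mkcond /=.
    rewrite exchange_big /=; apply: leq_sum => w _; rewrite inE.
    case: ifP => // /existsP[j /andP[j_inj wj]].
    by rewrite (bigD1 j) //= inE wj leq_addr.
  apply: (@leq_trans (\sum_(j : {ffun M -> 'I_s} | injectiveb j)
      (#|embs_into M A| * #|K| ^ (s - #|M|)))).
    apply: leq_sum => j /injectiveP j_inj.
    by have := card_ffun_comp_le (embs_into M A) j_inj; rewrite [#|'I_s|]card_ord.
  rewrite sum_nat_const leq_mul2r; apply/orP; right.
  by rewrite -[s in (s ^ _)%N]card_ord -card_ffun max_card.
have cnt_bound w : (cnt w <= (if injectiveb w then max_free M (pullback w) else 0) +
    s * ~~ injectiveb w + s * hit w)%N.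
  have [w_hit|w_nhit] := boolP (hit w); first by rewrite muln1; apply: leq_trans (leq_addl _ _).
  case: ifPn => w_inj; last by rewrite muln1 muln0 addn0 add0n.
  rewrite !muln0 !addn0; apply: (@leq_bigmax_cond _ _ (fun U : {set pullback w} => #|U|)).
  apply/asboolP => -[e [[e_inj e_holds] eA]]; move/negP: w_nhit; apply.
  apply/existsP; exists [ffun x => e x]; apply/andP; split.
    by apply/injectiveP => x y; rewrite !ffunE => /e_inj.
  apply/embs_intoP; split; last by move=> x; rewrite !ffunE; have := eA x; rewrite inE.
  have -> : [ffun x => w ([ffun x0 => e x0] x)] = [ffun x => (w \o e) x].
    by apply/ffunP => x; rewrite !ffunE.
  apply/embedding_finfun; apply: embedding_comp (conj e_inj e_holds) _.
  exact/pullback_embedding/injectiveP.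
have cnt_sum : #|K|%:R * (\sum_w (cnt w)%:R) = s%:R * #|A|%:R * #|K|%:R ^+ s :> R.
  have -> : \sum_w (cnt w)%:R =
      \sum_(i < s) \sum_(w : {ffun 'I_s -> K}) (w i \in A)%:R :> R.
    rewrite exchange_big /=; apply: eq_bigr => w _.
    rewrite /cnt -sum1_card natr_sum big_mkcond /=.
    by apply: eq_bigr => i _; rewrite inE; case: (w i \in A).
  rewrite [LHS]mulr_sumr.
  have sE (i : 'I_s) : #|K|%:R * (\sum_(w : {ffun 'I_s -> K}) (w i \in A)%:R) =
      #|K|%:R ^+ s * \sum_x (x \in A)%:R :> R := sum_sample (fun x => (x \in A)%:R) i.
  under eq_bigr do rewrite sE.
  rewrite sumr_card [#|'I_s|]card_ord -mulrA; congr (_ * _); rewrite mulrC; congr (_ * _).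
  rewrite -sum1_card natr_sum [RHS]big_mkcond.
  by apply: eq_bigr => x _; case: (x \in A).
have ninj : (\sum_(w : {ffun 'I_s -> K}) ~~ injectiveb w = #|K| ^ s - #|K| ^_ s)%N.
  have := card_inj_ffuns 'I_s K; rewrite [#|'I_s|]card_ord => <-.
  have -> : (#|K| ^ s = #|{: {ffun 'I_s -> K}}|)%N by rewrite card_ffun [#|'I_s|]card_ord.
  rewrite -[X in (X - _)%N]sum1_card -[X in (_ - X)%N]sum1_card [X in (_ - X)%N]big_mkcond /=.
  rewrite [X in (X - _)%N](eq_bigr (fun w : {ffun 'I_s -> K} =>
    (~~ injectiveb w + injectiveb w)%N)); last by move=> w _; case: (injectiveb w).
  rewrite big_split /= [X in (_ - X)%N](eq_bigr (fun w : {ffun 'I_s -> K} => injectiveb w : nat)).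
    by rewrite addnK.
  by move=> w _; rewrite inE; case: (injectiveb w).
rewrite -cnt_sum; apply: ler_wpM2l => //.
apply: (@le_trans _ _ (\sum_(w : {ffun 'I_s -> K})
  ((if injectiveb w then max_free M (pullback w) else 0)%:R +
    s%:R * (~~ injectiveb w)%:R + s%:R * (hit w)%:R))).
  by apply: ler_sum => w _; rewrite -!natrM -!natrD ler_nat.
rewrite !big_split /= -!mulr_sumr.
apply: lerD; first apply: lerD.
- rewrite [leRHS]big_mkcond; apply: ler_sum => w _.
  by case: (injectiveb w).
- by rewrite -natr_sum ninj.
- apply: ler_wpM2l => //; rewrite -natr_sum.
  have -> : (\sum_w hit w = #|finset hit|)%N.
    by rewrite -sum1_card [RHS]big_mkcond; apply: eq_bigr => w _; rewrite inE; case: (hit w).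
  by rewrite -!natrX -!natrM ler_nat -mulnA.
Qed.

End Sampling.

(** * The limit of a sequence of blow-ups *)

Section Sufficiency.
Variables (L : language) (R : realType).
Implicit Types (M N K D : fstruct L) (phi psi : fstruct L -> R).
Local Open Scope classical_set_scope.

Lemma cvg_expr_lt (x e : R) : 0 <= x < 1 -> 0 < e -> exists r, x ^+ r < e.
Proof.
move=> /andP[x_ge0 x_lt1] e_gt0.
have x_cvg : (x ^+ r) @[r --> \oo] --> (0 : R) by apply: cvg_expr; rewrite ger0_norm.
have [N _ NP] : \forall r \near \oo, x ^+ r < e by exact: (cvgr_lt _ x_cvg).
by exists N; apply: NP => /=.
Qed.

(** Samples of [S n] have small free sets on average, since this holds for blow-ups of [D] and [phi]
    determines the average. As [A n] receives many sample points, [sample_lower] forces many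
    embeddings of [M] in it. *)
Lemma sub_object_free_bounds phi (N : nat -> fstruct L) M : converges_to N phi ->
  (forall e : R, 0 < e -> exists D, [/\ (0 < #|D|)%N, free_bound M D e &
     \forall n \near \oo, exists (p : N n -> D) q, blowup_map p q]) ->
  Pset phi M.
Proof.
move=> N_phi N_free psi [S [A [c [S_phi c_gt0 A_c T_psi]]]].
(* Of the fraction [c / 2] of points in [A n], free sets take at most [4 * e = c / 6] and
   non-injective samples at most [c / 6]; the remaining [c / 6] is due to copies of [M]. *)
pose e : R := c / 24.
have e_gt0 : 0 < e by rewrite divr_gt0.
have [D [D_gt0 D_e D_bl]] := N_free e e_gt0.
have e4_gt0 : 0 < 4 * e ^+ 2 by rewrite mulr_gt0 ?exprn_gt0.
pose s := (maxn #|M| (Num.bound (#|D|%:R / (4 * e ^+ 2)))).+1.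
have Ms : (#|M| <= s)%N by rewrite leqW // leq_maxl.
have D_s : #|D|%:R <= 4 * e ^+ 2 * s%:R.
  rewrite -ler_pdivrMl // mulrC; apply: ltW.
  apply: (@lt_le_trans _ _ (Num.bound (#|D|%:R / (4 * e ^+ 2)))%:R).
    by apply: archi_boundP; rewrite divr_ge0 // ltW.
  by rewrite ler_nat leqW // leq_maxr.
have s_gt0 : 0 < s%:R :> R by rewrite ltr0n.
pose avg K : R := (\sum_(w : {ffun 'I_s -> K} | injectiveb w)
  (max_free M (pullback w))%:R) / #|K|%:R ^+ s.
have avg_cvg S' : converges_to S' phi -> avg (S' n) @[n --> \oo] -->
    \sum_(k : code L s | canonical_code k)
      (max_free M (of_code k))%:R * emb_limit phi (of_code k).
  move=> S'_phi.
  exact (@sum_injective_pullback_cvg L R S' phi s (fun K => (max_free M K)%:R : R) S'_phi).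
(* The bound with 3 holds along [N]; the slack up to 4 makes the strict inequality pass to all large
   terms of [S]. *)
have lim_lt : \sum_(k : code L s | canonical_code k)
      (max_free M (of_code k))%:R * emb_limit phi (of_code k) < 4 * e * s%:R.
  apply: (@le_lt_trans _ _ (3 * e * s%:R)); last first.
    by rewrite ltr_pM2r // ltr_pM2r // ltr_nat.
  apply: (cvgr_to_le (avg_cvg _ N_phi)); near=> n.
  have N_gt0 : 0 < #|N n|%:R :> R.
    rewrite ltr0n; apply: leq_trans (converges_to_ge N_phi n).
    by near: n; exists 1%N.
  have [p [q p_bl]] : exists (p : N n -> D) q, blowup_map p q by near: n.
  rewrite /avg ler_pdivrMr ?exprn_gt0 //.
  exact: (sum_max_free_blowup p_bl D_gt0 e_gt0 _ D_s D_e).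
have ninj_cvg : (#|S n| ^ s - #|S n| ^_ s)%:R / #|S n|%:R ^+ s @[n --> \oo] --> (0 : R).
  exact (@ninjective_cvg R _ s (converges_to_ge S_phi)).
pose e' : R := c / 6 / s%:R ^+ #|M|.
have e'_gt0 : 0 < e' by rewrite !divr_gt0 ?exprn_gt0.
apply/(limit_gt0P M T_psi); exists e' => //; near=> n.
have n_gt0 : (0 < n)%N by near: n; exists 1%N.
have S_gt0 : 0 < #|S n|%:R :> R.
  by rewrite ltr0n; exact: leq_trans (converges_to_ge S_phi n).
have T_gt0 : 0 < #|induced_on (A n)|%:R :> R.
  by rewrite ltr0n; exact: leq_trans (converges_to_ge T_psi n).
rewrite /emb_density ler_pdivlMr ?exprn_gt0 // card_embs_induced.
apply: (@le_trans _ _ (e' * #|S n|%:R ^+ #|M|)).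
  rewrite ler_wpM2l ?(ltW e'_gt0) // lerXn2r ?nnegrE //.
  by rewrite card_induced ler_nat max_card.
have avg_le : avg (S n) <= 4 * e * s%:R.
  by near: n; apply: (cvgr_le _ (avg_cvg _ S_phi)).
have ninj_le : (#|S n| ^ s - #|S n| ^_ s)%:R / #|S n|%:R ^+ s <= c / 6.
  near: n; apply: (cvgr_le _ ninj_cvg).
  by rewrite divr_gt0.
have A_ge : c / 2 <= #|A n|%:R / #|S n|%:R.
  near: n; apply: (cvgr_ge _ A_c).
  by rewrite ltr_pdivrMr // ltr_pMr // ltr1n.
rewrite /avg ler_pdivrMr ?exprn_gt0 // in avg_le.
rewrite ler_pdivrMr ?exprn_gt0 // in ninj_le; rewrite ler_pdivlMr // in A_ge.
have := sample_lower R (A n) Ms; move: avg_le ninj_le A_ge.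
set W := \sum_(w | _) _; set J := (_ - _)%:R; set a := #|A n|%:R.
set E := #|embs_into _ _|%:R; set n' := #|S n|%:R in S_gt0 *.
have -> : n' ^+ s = n' ^+ #|M| * n' ^+ (s - #|M|) by rewrite -exprD subnKC.
set x := n' ^+ #|M|; set y := n' ^+ (s - #|M|) => W_le J_le A_ge le.
have x_gt0 : 0 < x by rewrite exprn_gt0.
have y_gt0 : 0 < y by rewrite exprn_gt0.
rewrite /e' mulrAC ler_pdivrMr ?exprn_gt0 // mulrC.
set z := s%:R ^+ #|M| in le *.
suff : s%:R * n' * y * (c / 6 * x) <= s%:R * n' * y * (z * E).
  by rewrite ler_pM2l ?mulr_gt0 // [E * z]mulrC mulrC.
have le1 : s%:R * (c / 2 * n') * (x * y) <= s%:R * a * (x * y).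
  by rewrite ler_wpM2r ?mulr_ge0 ?(ltW x_gt0) ?(ltW y_gt0) // ler_wpM2l // ltW.
have le2 : n' * W <= n' * (4 * e * s%:R * (x * y)) by rewrite ler_wpM2l // ltW.
have le3 : n' * s%:R * J <= n' * s%:R * (c / 6 * (x * y)).
  by rewrite ler_wpM2l // mulr_ge0 // ltW.
by move: le le1 le2 le3; rewrite /e; lra.
Unshelve. all: by end_near. Qed.

(** Each step blows up by [G k], which shrinks the [G k]-free sets, and then by [M], which makes the
    size at least double even if [G k] is a single vertex. *)
Lemma exists_blowup_sequence (F : set (fstruct L)) M (G : nat -> fstruct L) :
  weakly_closed_under_substitutions F -> F M -> (2 <= #|M|)%N ->
  (forall k, F (G k) /\ (0 < #|G k|)%N) ->
  exists N : nat -> fstruct L, forall k, [/\ F (N k), (k < #|N k|)%N,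
    exists (p : N k.+1 -> N k) q, blowup_map p q &
    forall e : R, free_bound (G k) (N k) e ->
      free_bound (G k) (N k.+1) (e * (#|G k|.-1%:R / #|G k|%:R))].
Proof.
move=> F_sub FM M_ge2 FG.
have /choice[step stepP] : forall kN : nat * fstruct L, exists K, F kN.2 ->
    [/\ F K, (2 * #|kN.2| <= #|K|)%N,
      exists (p : K -> kN.2) q, blowup_map p q &
      forall e : R, free_bound (G kN.1) kN.2 e ->
        free_bound (G kN.1) K (e * (#|G kN.1|.-1%:R / #|G kN.1|%:R))].
  move=> [k N]; case: (pselect (F N)) => [FN|nFN]; last by exists N.
  have [FGk Gk_gt0] := FG k.
  have [K FK [[p p_bl] K_free]] := free_bound_full_blowup R F_sub FN FGk Gk_gt0.
  have [K' FK' [[p' p'_bl] _]] := free_bound_full_blowup R F_sub FK FM (ltnW M_ge2).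
  exists K' => _; split => //=.
  - rewrite (card_blowup p'_bl) (card_blowup p_bl) mulnC leq_mul //.
    by rewrite leq_pmulr.
  - by exists (p \o p'), (#|G k| * #|M|)%N; exact: blowup_comp.
  - by move=> e /K_free; exact: free_bound_blowup p'_bl.
pose N := fix N k := if k is j.+1 then step (j, N j) else M.
have FN k : F (N k) by elim: k => //= k IHk; have [] := stepP (k, N k) IHk.
exists N => k; have [_ N_ge N_bl N_free] := stepP (k, N k) (FN k).
split=> //; elim: k {N_ge N_bl N_free} => [|k IHk]; first exact: ltnW.
have [_ N_ge _ _] := stepP (k, N k) (FN k).
by apply: leq_trans N_ge; rewrite /= mul2n -addnn -addn1 leq_add // (leq_trans _ IHk).
Qed.

(** An index encodes a structure together with a natural number, so each structure has infinitely
    many indices; [M] is the default value. *)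
Lemma infinitely_often_enumeration (P : set (fstruct L)) M : P M ->
  exists G : nat -> fstruct L, (forall k, P (G k)) /\
    forall K, P K -> forall n, exists2 k, (n <= k)%N & G k = K.
Proof.
move=> PM.
exists (fun k => if (unpickle k : option (nat * {s : nat & code L s})) is Some ic then
  if `[< P (decode ic.2) >] then decode ic.2 else M else M); split.
  by move=> k; case: (unpickle k) => // ic; case: asboolP.
move=> K PK n; apply: contrapT => noK.
(* Otherwise the [n + 1] distinct indices of [K] with counters up to [n] would all lie below [n]. *)
have lt_n (i : 'I_n.+1) : (pickle (i : nat, encode K) < n)%N.
  rewrite ltnNge; apply/negP => ni; apply: noK; exists (pickle (i : nat, encode K)) => //.
  by rewrite pickleK /= encodeK; case: asboolP.
have : injective (fun i => Ordinal (lt_n i)).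
  by move=> i j [] /(pcan_inj pickleK) [] /val_inj.
by move=> /leq_card; rewrite !card_ord ltnn.
Qed.

(** The inclusions [Qset phi] in [F] in [Pset phi] in [Qset phi] are proved. The first holds as
    every [N k] lies in the hereditary family [F], the second by [sub_object_free_bounds]. *)
Lemma closed_strongly_persistent (F : set (fstruct L)) M :
  F M -> (2 <= #|M|)%N ->
  weakly_closed_under_substitutions F -> closed_under_substructures F ->
  strongly_persistent R F.
Proof.
move=> FM M_ge2 F_sub F_her.
have [G [FG G_all]] := @infinitely_often_enumeration
  [set K | F K /\ (0 < #|K|)%N] M (conj FM (ltnW M_ge2)).
have [N NP] := exists_blowup_sequence F_sub FM M_ge2 FG.
have N_ge n : (n <= #|N n|)%N by have [_ /ltnW] := NP n.
have zero01 (n : nat) : 0 <= (fun=> 0 : R) n <= 1 by rewrite lexx ler01.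
have [h [h_incr [phi [_ [Nh_phi _]]]]] := convergent_subsequence N_ge zero01.
have phi_lim : is_limit phi by exists (N \o h).
have N_bl d j : exists (p : N (d + j)%N -> N d) q, blowup_map p q.
  elim: j => [|j [p [q p_bl]]].
    by rewrite addn0; exists id, 1%N; exact: blowup_id.
  rewrite addnS; have [_ _ [p' [q' p'_bl]] _] := NP (d + j)%N.
  by exists (p \o p'), (q * q')%N; exact: blowup_comp.
have Q_F : Qset phi `<=` F.
  move=> K /(limit_gt0P K Nh_phi)[e e_gt0 [n _ /(_ n (leqnn n))]].
  move=> /(lt_le_trans e_gt0) dens_gt0.
  have /card_gt0P[w /embsP w_emb] : (0 < #|embs K (N (h n))|)%N.
    rewrite lt0n; apply/negP => /eqP embs0.
    by move: dens_gt0; rewrite /emb_density embs0 mul0r ltxx.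
  by have [FN _ _ _] := NP (h n); apply: F_her FN; exists w.
have F_P : F `<=` Pset phi.
  suff F_P K : F K -> (0 < #|K|)%N -> Pset phi K.
    (* The empty structure cannot be used for blowing up; it is a substructure of [M]. *)
    move=> K FK; have [K0|K_gt0] := posnP #|K|; last exact: F_P.
    apply: Pset_closed_under_substructures (F_P M FM (ltnW M_ge2)).
    exact: empty_substructure.
  move=> FK K_gt0; apply: sub_object_free_bounds Nh_phi _ => e e_gt0.
  pose x : R := #|K|.-1%:R / #|K|%:R.
  have x01 : 0 <= x < 1.
    rewrite divr_ge0 //= ltr_pdivrMr ?ltr0n // mul1r ltr_nat.
    by rewrite ltn_predL.
  have [r xr] := cvg_expr_lt x01 e_gt0.
  (* Each occurrence of [K] in the enumeration contributes a factor [x], and blow-ups in between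
     preserve the bound; [r] occurrences suffice. *)
  have [d Nd_free] : exists d, free_bound K (N d) (x ^+ r).
    elim: (r) => [|j [d Nd]].
      by exists 0%N => U _; rewrite mul1r ler_nat max_card.
    have [k dk Gk] := G_all K (conj FK K_gt0) d.
    have [_ _ _ Nk_free] := NP k; rewrite Gk in Nk_free.
    exists k.+1; rewrite exprSr; apply: Nk_free.
    have := N_bl d (k - d)%N; rewrite subnKC // => -[p [q p_bl]].
    exact: free_bound_blowup p_bl Nd.
  exists (N d); split.
  - by have [_ Nd_gt _ _] := NP d; exact: leq_ltn_trans Nd_gt.
  - move=> U /Nd_free /le_trans; apply; rewrite ler_wpM2r //; exact: ltW.
  - exists d => // n /= dn.
    have dh : (d <= h n)%N by apply: leq_trans dn (homo_ltn_ge h_incr n).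
    by have := N_bl d (h n - d)%N; rewrite subnKC.
have P_Q := Pset_sub_Qset phi_lim.
exists phi => //; split; apply/seteqP; split => //.
- by move=> K /Q_F /F_P.
- by move=> K /P_Q /Q_F.
Qed.

End Sufficiency.

Theorem theorem7p9 (R : realType) (L : language) (F : set (fstruct L))
    (F_iso : iso_closed F)
    (F_ge2 : exists2 M : fstruct L, F M & (2 <= #|M|)%N) :
  (strongly_persistent R F <->
     weakly_closed_under_substitutions F /\ closed_under_substructures F) /\
  ((forall P : L, (arity P <= 2)%N) ->
     (strongly_persistent R F <-> persistent R F)).
Proof.
have [M FM M_ge2] := F_ge2.
have suff_closed : weakly_closed_under_substitutions F /\
    closed_under_substructures F -> strongly_persistent R F.
  by move=> [F_sub F_her]; exact: closed_strongly_persistent FM M_ge2 F_sub F_her.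
split; first by split; [exact: strongly_persistent_closed | exact: suff_closed].
move=> arity2; split; first by move=> [phi phi_lim [_ ?]]; exists phi.
by move=> /(persistent_closed arity2); exact: suff_closed.
Qed.
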